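(* Let $H$ be the half-line discrete Schrödinger operator on $\ell^2(\mathbb{N})$ with bounded real potential $V$. Assume that $\{q_\ell\}_{\ell=1}^\infty$ is a sequence of integers $>1$ with $q_\ell\to\infty$ such that $\{\mathfrak{E}_{q_\ell}\}_{\ell=1}^\infty$ is uniformly clustered by $\{U_\ell=\{I_j^\ell\}_{j=1}^{k_\ell}\}_{\ell=1}^\infty$ with exponents $\{\alpha_\ell,\xi_\ell,\mu\}$. Suppose, moreover, that $\{U_\ell\}_{\ell=1}^\infty$, with scales $\varepsilon_\ell=q_\ell^{-1/\alpha_\ell}$, scales nicely with exponents $\mu$ and $\omega$ for some $0<\omega<1$, and that for some $\zeta>0$, $$2\omega\Bigl(\frac{\mu-1}{\mu-\omega}\Bigr)+\zeta<\xi_\ell\alpha_\ell\qquad\text{for all }\ell .$$ Then $\alpha_u^-\le\liminf_{\ell\to\infty}\alpha_\ell$. If, moreover, the sequence $\{q_\ell\}_{\ell=1}^\infty$ is exponentially growing, then $\alpha_u^+\le\limsup_{\ell\to\infty}\alpha_\ell$.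
   Context: $\mathbb{N}=\{1,2,\dots\}$; $V=(V_n)_{n\in\mathbb{N}}$ is a bounded real sequence. The operator $H$ on $\ell^2(\mathbb{N})$ is $(H\psi)_n=\psi_{n+1}+\psi_{n-1}+V_n\psi_n$ for $n\ge2$ and $(H\psi)_1=\psi_2+V_1\psi_1$. For real $q\ge0$ and $T>0$, $$P(q,T)=\sum_{n>q}\frac2T\int_0^\infty\bigl|\langle\delta_n,e^{-itH}\delta_1\rangle\bigr|^2e^{-2t/T}\,dt .$$ The exponents are $$\alpha_u^+=\sup\Bigl\{\alpha>0:\limsup_{T\to\infty}\tfrac{\log P(T^\alpha,T)}{\log T}>-\infty\Bigr\},\qquad \alpha_u^-=\sup\Bigl\{\alpha>0:\liminf_{T\to\infty}\tfrac{\log P(T^\alpha,T)}{\log T}>-\infty\Bigr\}$$ (the supremum of the empty set is taken to be $0$). A sequence $\{a_n\}$ of nonnegative numbers is exponentially growing if $\sup_n a_{n+1}/a_n<\infty$ and $\inf_n a_{n+1}/a_n>1$. For an integer $q>1$, $\mathfrak{E}_q=\{\widetilde E_{q,j}\}_{j=1}^q$ is the set of the $q$ (simple, real) eigenvalues of $H^q(\pi/2)$, where $H^q(k)$ is the $q\times q$ Hermitian matrix with diagonal entries $V_1,\dots,V_q$, entries $1$ in positions $(n,n\pm1)$, entry $e^{-ik}$ in position $(1,q)$ and $e^{ik}$ in position $(q,1)$, and all other entries $0$ (for $q=2$ the entries falling in the same position are added). Clustering: $\mathfrak{E}_q$ is $(\varepsilon,\xi)$-clustered by $\{I_j\}_{j=1}^k$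 ($k\le q$) if the $I_j$ are disjoint closed intervals, each of length at most $\varepsilon$, with $\mathfrak{E}_q\subseteq\bigcup_jI_j$, and every $I_j$ contains at least $q^\xi$ points of $\mathfrak{E}_q$. Uniform clustering: $\{\mathfrak{E}_{q_\ell}\}_{\ell}$ is uniformly clustered by $\{U_\ell=\{I_j^\ell\}_{j=1}^{k_\ell}\}_\ell$ with exponents $\{\alpha_\ell,\xi_\ell,\mu\}$ if $\mathfrak{E}_{q_\ell}$ is $(q_\ell^{-1/\alpha_\ell},\xi_\ell)$-clustered by $U_\ell$ for each $\ell$ and: (i) $\ell_1<\ell_2$ implies $q_{\ell_1}^{-1/\alpha_{\ell_1}}>q_{\ell_2}^{-1/\alpha_{\ell_2}}$; (ii) $\mu\ge1$ and there is a constant $C_1>0$ with $\inf_{1\le j\le k_\ell}|I_j^\ell|\ge C_1q_\ell^{-\mu/\alpha_\ell}$ for all $\ell$; (iii) there is $\delta>0$ with $\delta<\xi_\ell<1-\delta$ and $\delta<\alpha_\ell<1$ for all $\ell$; (iv) with $\bar\xi_\ell=\log\bigl(\sup_{1\le j\le k_\ell}\#(\mathfrak{E}_{q_\ell}\cap I_j^\ell)\bigr)/\log q_\ell$, there is a constant $C_2$ with $\bar\xi_\ell-\xi_\ell\le C_2/\log q_\ell$ for all $\ell$. Nice scaling: let $\{U_\ell=\{I_j^\ell\}_{j=1}^{k_\ell}\}_\ell$ be a sequence of finite sets of intervals such that $\varepsilon_\ell\ge|I_j^\ell|\ge C\varepsilon_\ell^\mu$ for a monotonically decreasing sequence $\{\varepsilon_\ell\}$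 and constants $C>0$, $\mu\ge1$, and let $0<\omega<1$. Then $\{U_\ell\}$ (with scales $\varepsilon_\ell$) scales nicely with exponents $\mu$ and $\omega$ if for every $0<\varepsilon<1$ there is a finite set of (not necessarily disjoint) intervals $U_\varepsilon=\{I_j^\varepsilon\}_{j=1}^{k_\varepsilon}$, of length at most $\varepsilon$ and at least $C\varepsilon^\mu$, with $U_{\varepsilon_\ell}=U_\ell$, such that: (i) if $\varepsilon_1>\varepsilon_2$ then for any $1\le j\le k_{\varepsilon_2}$ there is $1\le m\le k_{\varepsilon_1}$ with $I_j^{\varepsilon_2}\subseteq I_m^{\varepsilon_1}$; (ii) there is a constant $C_3>0$ such that if $\varepsilon_1>\varepsilon_2$ then for any $1\le m\le k_{\varepsilon_1}$, $\#\{j: I_j^{\varepsilon_2}\cap I_m^{\varepsilon_1}\ne\emptyset\}\le C_3(\varepsilon_1/\varepsilon_2)^\omega$. *)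

(* Defs.v *)
From HB Require Import structures.
From mathcomp Require Import all_boot all_order all_algebra finmap.
From mathcomp Require Import all_classical all_reals all_analysis.
From mathcomp Require Import complex.

Set Implicit Arguments.
Unset Strict Implicit.
Unset Printing Implicit Defensive.

Import Order.TTheory GRing.Theory Num.Theory numFieldNormedType.Exports.

Local Open Scope classical_set_scope.
Local Open Scope ring_scope.

(* A sequence (psi_n)_{n >= 1} is a function nat -> _ whose value at 0 is
   irrelevant: no definition below looks at V 0 or at psi 0. *)

Section Dynamics.
Variable R : realType.
Implicit Types (V : nat -> R) (psi : nat -> R[i]).

Definition schrodinger V psi : nat -> R[i] := fun n =>
  match n with
  | 0%N => 0
  | 1%N => psi 2 + (V 1)%:C%C * psi 1
  | (m.+1)%N => psi m.+2 + psi m + (V m.+1)%:C%C * psi m.+1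
  end.

Definition delta (n : nat) : nat -> R[i] := fun m => (m == n)%:R.

(* The vector e^{-itH} psi.  For bounded V the operator H is bounded, so
   e^{-itH} = \sum_k (-it)^k / k! H^k in operator norm; the n-th coordinate of
   e^{-itH} psi is therefore the sum of the series of n-th coordinates.  The
   alias ^o carries the usual topology of the complex numbers. *)
Definition evolution V (t : R) psi : nat -> R[i] := fun n =>
  limn (series (fun k => (0 -i* t)%C ^+ k / k`!%:R
                         * iter k (schrodinger V) psi n : R[i]^o)).

(* <delta_n, phi> is the n-th coordinate of phi. *)
Definition amplitude V (t : R) (n : nat) : R[i] :=
  evolution V t (delta 1) n.

Definition outside_prob V (q T : R) : \bar R :=
  (\sum_(1 <= n <oo | (q < n%:R)%R)
     ((2 / T)%:E * \int[lebesgue_measure]_(t in `[0%R, +oo[)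
        (Normc.normc (amplitude V t n) ^+ 2 * expR (- 2 * t / T))%:E))%E.

Definition log_ratio V (a : R) : R -> \bar R := fun T =>
  (lne (outside_prob V (T `^ a) T) * ((ln T)^-1)%:E)%E.

(* Adding 0 to a set of positive numbers only makes the supremum of the empty
   set equal to 0. *)
Definition alpha_u_plus V : \bar R :=
  ereal_sup (0%E |` [set a%:E | a in
    [set a : R | 0 < a /\ (-oo < limf_esup (log_ratio V a) +oo%R)%E]]).

Definition alpha_u_minus V : \bar R :=
  ereal_sup (0%E |` [set a%:E | a in
    [set a : R | 0 < a /\ (-oo < limf_einf (log_ratio V a) +oo%R)%E]]).

Definition exponentially_growing (a : nat -> R) : Prop :=
  [/\ forall n, 0 <= a n,
      has_ubound (range (fun n => a n.+1 / a n)) &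
      1 < inf (range (fun n => a n.+1 / a n))].

End Dynamics.

Section Spectrum.
Variable R : realType.
Implicit Types (V : nat -> R).

(* Rows and columns are numbered from 0, so row i is row i + 1 of the usual
   matrix.  For q = 2 the off-diagonal and the corner entries add up. *)
Definition periodic_mx V (q : nat) (k : R) : 'M[R[i]]_q :=
  \matrix_(i < q, j < q)
    ((V i.+1)%:C%C *+ (i == j)
     + ((j == i.+1 :> nat) || (i == j.+1 :> nat))%:R
     + (cos k -i* sin k)%C *+ ((i == 0 :> nat) && (j.+1 == q :> nat))
     + (cos k +i* sin k)%C *+ ((i.+1 == q :> nat) && (j == 0 :> nat))).

Definition frakE V (q : nat) : set R :=
  [set e | eigenvalue (periodic_mx V q (pi / 2)) e%:C%C].

Definition num_in V (q : nat) (I : interval R) : nat :=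
  #|` fset_set (frakE V q `&` [set` I]) |.

End Spectrum.

Section Clustering.
Variable R : realType.
Implicit Types (V : nat -> R) (I J : interval R) (q : nat -> nat).
Implicit Types (U : nat -> {fset interval R}).

Definition len I : \bar R := lebesgue_measure [set` I].

Definition closed_interval I : Prop :=
  exists a b : R, a <= b /\ I = `[a, b].

Definition clustered V (n : nat) (eps xi : R) (S : {fset interval R}) : Prop :=
  [/\ (#|` S| <= n)%N,
      forall I, I \in S -> closed_interval I /\ (len I <= eps%:E)%E,
      forall I J, I \in S -> J \in S -> I != J ->
        [set` I] `&` [set` J] = set0,
      forall e, frakE V n e -> exists2 I, I \in S & e \in I &
      forall I, I \in S -> n%:R `^ xi <= (num_in V n I)%:R].

Definition scale q (alpha : nat -> R) (l : nat) : R :=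
  (q l)%:R `^ (- (alpha l)^-1).

Definition xibar V q U (l : nat) : R :=
  ln (\max_(I <- U l) num_in V (q l) I)%N%:R / ln (q l)%:R.

Definition uniformly_clustered V q U (alpha xi : nat -> R) (mu : R) : Prop :=
  (forall l, clustered V (q l) (scale q alpha l) (xi l) (U l)) /\
  [/\ forall l1 l2, (l1 < l2)%N -> scale q alpha l2 < scale q alpha l1,
      1 <= mu /\
        (exists2 C1 : R, 0 < C1 & forall l I, I \in U l ->
           ((C1 * (q l)%:R `^ (- (mu / alpha l)))%:E <= len I)%E),
      exists2 d : R, 0 < d & forall l,
        d < xi l < 1 - d /\ d < alpha l < 1 &
      exists C2 : R, forall l,
        xibar V q U l - xi l <= C2 / ln (q l)%:R].

(* The intervals of the interpolating families W eps may be open, closed or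
   half-open; W eps is only constrained for 0 < eps < 1. *)
Definition scales_nicely U (eps : nat -> R) (mu omega : R) : Prop :=
  [/\ decreasing_seq eps, 1 <= mu, 0 < omega < 1 &
  exists2 C : R, 0 < C &
    (forall l I, I \in U l ->
       ((C * eps l `^ mu)%:E <= len I <= (eps l)%:E)%E) /\
    exists W : R -> {fset interval R},
    [/\ forall e : R, 0 < e < 1 -> forall I, I \in W e ->
          ((C * e `^ mu)%:E <= len I <= e%:E)%E,
        forall l, W (eps l) = U l,
        forall e1 e2 : R, 0 < e2 -> e2 < e1 -> e1 < 1 ->
          forall J, J \in W e2 ->
          exists2 I, I \in W e1 & [set` J] `<=` [set` I] &
        exists2 C3 : R, 0 < C3 &
          forall e1 e2 : R, 0 < e2 -> e2 < e1 -> e1 < 1 ->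
          forall I, I \in W e1 ->
            (#|` [fset J in W e2 | `[< [set` J] `&` [set` I] !=set0 >]]%fset|)%:R
              <= C3 * (e1 / e2) `^ omega]].

End Clustering.

(* Main.v *)
(** Idea.  Let [D q] be the trace of the transfer matrix over [q] sites, a monic
    polynomial of degree [q].  Quasi-periodic solutions show that the zeros of
    [D q], [D q - 2] and [D q + 2] are real and that [frakE V q] is the zero set
    of [D q].

    (1) For [h] at least the length of the clusters, [D q] is exponentially large
    in the size [n] of the clusters on the whole line [Im z = h].  Indeed
    [|D q (x + ih)|^2 = \prod_e ((x - e)^2 + h^2)], as a function of [x], has no
    local minimum at distance more than [h] from all the zeros [e]; so it is
    minimal at a point [x] having a whole cluster within distance [2h].  There
    either [D q x] is not small and each zero [e] of the cluster contributes a
    factor [1 + h^2 / (x - e)^2 >= 5/4], or the same argument applies to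
    [D q ^+ 2 - 4], whose zeros separate those of [D q].

    (2) The flux [Im (u_{n+1} conj u_n)] of a solution changes by [Im z |u_n|^2]
    from site to site.  Applied to the Dirichlet and Neumann solutions and to the
    resolvent of a finite truncation of [H] this bounds the resolvent entries
    beyond site [q + 1] by a power of [1 / Im z] divided by [|D q z|].

    (3) [e^{-itH}] is approximated by [(1 + itH/k)^{-k}], hence by a combination of
    [k] resolvents with poles of height at least [A / t] over the real axis; the
    coefficients grow like [e^{2A}] and the error decays like [e^{-A}].  With [A] a
    small multiple of a power of [q], (1) and (2) make [P(q + 1, T)] smaller than
    [exp (- c q^delta)] for all [T <= q^{1 / alpha}]. *)

Require Import Defs.
From HB Require Import structures.
From mathcomp Require Import all_boot all_order all_algebra finmap.
From mathcomp Require Import all_classical all_reals all_analysis.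
From mathcomp Require Import complex.
From mathcomp Require Import measurable_realfun ring lra zify.
From mathcomp Require Import cyclic cyclotomic separable sesquilinear spectral.
Import Order.TTheory GRing.Theory Num.Theory numFieldNormedType.Exports.

Set Implicit Arguments.
Unset Strict Implicit.
Unset Printing Implicit Defensive.

Local Open Scope classical_set_scope.
Local Open Scope ring_scope.
Local Open Scope complex_scope.

(** * Products of distances from a point to real zeros *)

Lemma horner_prod_XsubC (R : comNzRingType) (s : seq R) (x : R) :
  (\prod_(e <- s) ('X - e%:P)).[x] = \prod_(e <- s) (x - e).
Proof. by rewrite horner_prod; apply: eq_bigr => e _; rewrite hornerXsubC. Qed.

Lemma small_below_all (R : realFieldType) (s : seq R) :
  {in s, forall d, 0 < d} ->
  exists2 t : R, 0 < t & {in s, forall d, t < d}.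
Proof.
elim: s => [|d s IH] sP; first by exists 1.
have [|t t0 ts] := IH; first by move=> e es; apply: sP; rewrite in_cons es orbT.
have d0 : 0 < d by apply: sP; rewrite mem_head.
exists (Num.min (d / 2) t); first by rewrite lt_min t0 divr_gt0.
move=> e; rewrite in_cons => /predU1P [->|/ts te].
  by rewrite gt_min; apply/orP; left; lra.
by rewrite gt_min te orbT.
Qed.

(** The factors pair up to [(x - e) ^+ 2 - t ^+ 2], which lies strictly between 0 and [(x - e) ^+ 2]
    once [t] is below every distance [|x - e|]. Hence the modulus of the product has no local
    minimum off its zeros. *)
Lemma prod_gap_lt (R : realFieldType) (s : seq R) (x : R) :
  s != [::] -> (forall e, e \in s -> x != e) ->
  exists2 t0 : R, 0 < t0 & forall t, 0 < t < t0 ->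
    `|\prod_(e <- s) (x + t - e) * \prod_(e <- s) (x - t - e)|
      < `|\prod_(e <- s) (x - e)| ^+ 2.
Proof.
move=> s0 xs.
have [t t_gt0 tlt] : exists2 t : R, 0 < t & {in [seq `|x - e| | e <- s], forall d, t < d}.
  apply: small_below_all => _ /mapP[e es ->].
  by rewrite normr_gt0 subr_eq0 xs.
exists t => // u /andP[u0 ut].
rewrite -big_split /= !normr_prod -prodrXl.
rewrite big_seq [X in _ < X]big_seq.
apply: ltr_prod; first by case: s s0 {xs tlt} => //= a s _; rewrite mem_head.
move=> e es; rewrite normr_ge0 /=.
have : t < `|x - e| by apply: tlt; apply: map_f.
have -> : (x + u - e) * (x - u - e) = (x - e) ^+ 2 - u ^+ 2 by ring.
move=> h; rewrite real_normK ?num_real//.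
have h2 : u ^+ 2 < (x - e) ^+ 2.
  by rewrite -(real_normK (num_real (x - e))) ltr_pXn2r// ?nnegrE ?ltW// (lt_trans ut).
by rewrite ger0_norm ?subr_ge0 ?ltW// ltrBlDr ltrDl exprn_gt0.
Qed.

(* The midpoint form of strict log-concavity, valid away from the roots. *)
Lemma prod_height_gap_lt (R : realFieldType) (s : seq R) (x h : R) :
  s != [::] -> 0 < h -> (forall e, e \in s -> h < `|x - e|) ->
  exists2 t : R, 0 < t &
    (\prod_(e <- s) ((x + t - e) ^+ 2 + h ^+ 2)) * \prod_(e <- s) ((x - t - e) ^+ 2 + h ^+ 2)
      < (\prod_(e <- s) ((x - e) ^+ 2 + h ^+ 2)) ^+ 2.
Proof.
move=> s0 h0 xs.
have [t t_gt0 tlt] : exists2 t : R, 0 < t & {in [seq `|x - e| - h | e <- s], forall d, t < d}.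
  apply: small_below_all => _ /mapP[e es ->]; by rewrite subr_gt0 xs.
exists t => //.
rewrite -big_split -prodrXl /=.
rewrite big_seq [X in _ < X]big_seq.
apply: ltr_prod; first by case: s s0 {xs tlt} => //= a s _; rewrite mem_head.
move=> e es.
have : t < `|x - e| - h by apply: tlt; apply/mapP; exists e.
set y := x - e => ty.
have -> : x + t - e = y + t by rewrite /y; ring.
have -> : x - t - e = y - t by rewrite /y; ring.
apply/andP; split; first by rewrite mulr_ge0// addr_ge0 ?sqr_ge0.
(* Since [|y| > t + h], the quantity [y ^+ 2 - h ^+ 2] exceeds [t ^+ 2]; this gives the sign of the
   factored difference below. *)
have y2 : (t + h) ^+ 2 < y ^+ 2.
  rewrite -(real_normK (num_real y)) ltr_pXn2r// ?nnegrE ?addr_ge0 ?ltW//; lra.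
rewrite -subr_gt0.
have -> : (y ^+ 2 + h ^+ 2) ^+ 2 - ((y + t) ^+ 2 + h ^+ 2) * ((y - t) ^+ 2 + h ^+ 2)
   = t ^+ 2 * (2 * (y ^+ 2 - h ^+ 2) - t ^+ 2) by ring.
rewrite mulr_gt0 ?exprn_gt0//; nra.
Qed.

(** * Growth of a polynomial off the real axis when its zeros cluster *)

Section TraceLowerBound.
Variable R : realType.
Implicit Types (es fs : seq R).

Lemma continuous_prod_sub es : continuous (fun x : R => \prod_(e <- es) (x - e)).
Proof.
have -> : (fun x : R => \prod_(e <- es) (x - e)) = horner (\prod_(e <- es) ('X - e%:P)).
  by apply/funext => x; rewrite horner_prod_XsubC.
exact: continuous_horner.
Qed.

Lemma continuous_prod_height es (h : R) :
  continuous (fun x : R => \prod_(e <- es) ((x - e) ^+ 2 + h ^+ 2)).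
Proof.
have -> : (fun x : R => \prod_(e <- es) ((x - e) ^+ 2 + h ^+ 2))
     = horner (\prod_(e <- es) (('X - e%:P) ^+ 2 + (h ^+ 2)%:P)).
  by apply/funext => x; rewrite horner_prod; apply: eq_bigr => e _; rewrite !hornerE.
exact: continuous_horner.
Qed.

(** A minimizer over a large compact interval is a global one; if every zero were farther than [h]
    from it, [prod_height_gap_lt] would give a smaller value on one of its two sides. *)
Lemma min_height_near_root es (h x : R) : es != [::] -> 0 < h ->
  exists2 x0 : R, \prod_(e <- es) ((x0 - e) ^+ 2 + h ^+ 2)
                    <= \prod_(e <- es) ((x - e) ^+ 2 + h ^+ 2) &
     exists2 e, e \in es & `|x0 - e| <= h.
Proof.
move=> es0 h0; pose F y := \prod_(e <- es) ((y - e) ^+ 2 + h ^+ 2).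
(* As [S] bounds every [|e|], a point with [|y| >= X] is farther from each zero than [x] is, so
   nothing outside [[-X, X]] beats [F x]. *)
pose S := \sum_(e <- es) `|e|; pose X : R := `|x| + 2 * S + 1.
have S0 : 0 <= S by rewrite sumr_ge0.
have nx0 : 0 <= `|x| by [].
have leS e : e \in es -> `|e| <= S.
  move=> ee; rewrite /S (big_rem e)//= lerDl; apply: sumr_ge0 => *; exact: normr_ge0.
have X0 : 0 < X by rewrite /X; lra.
have NxX : - X <= x <= X.
  by rewrite -ler_norml /X; lra.
have FX y : `|y| = X -> F x < F y.
  move=> yX; rewrite /F big_seq [X in _ < X]big_seq.
  apply: ltr_prod.
    by case: (es) es0 => //= a s _; rewrite mem_head.
  move=> e ee; rewrite addr_ge0 ?sqr_ge0//= ltrD2r.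
  have := leS e ee => eS.
  rewrite -(real_normK (num_real (x - e))) -(real_normK (num_real (y - e))).
  rewrite ltr_pXn2r// ?nnegrE//.
  have := ler_normB x e; have := lerB_dist y e; rewrite yX /X; lra.
have [x0 x0X x0min] := @EVT_min R F (- X) X (ge0_cp (ltW X0)).2
     (continuous_subspaceT (@continuous_prod_height es h)).
exists x0.
  exact: x0min.
apply: contrapT => far.
have [t t0] : exists2 t : R, 0 < t & F (x0 + t) * F (x0 - t) < F x0 ^+ 2.
  apply: prod_height_gap_lt => // e ee; rewrite ltNge; apply/negP => le.
  by apply: far; exists e.
have Fx0x : F x0 <= F x.
  exact: x0min.
have glob y : F x0 <= F y.
  have [yX|Xy] := leP `|y| X.
    by apply: x0min; rewrite in_itv/= -ler_norml.
  apply: le_trans Fx0x _; rewrite /F big_seq [X in _ <= X]big_seq; apply: ler_prod => e ee.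
  rewrite addr_ge0 ?sqr_ge0//=.
  rewrite lerD2r -(real_normK (num_real (x - e))) -(real_normK (num_real (y - e))).
  rewrite ler_pXn2r// ?nnegrE//.
  have := leS e ee.
  have := ler_normB x e; have := lerB_dist y e; move: Xy; rewrite /X; lra.
have Fpos y : 0 <= F y by apply: prodr_ge0 => e _; rewrite addr_ge0 ?sqr_ge0.
rewrite ltNge => /negP; apply.
by rewrite expr2 ler_pM.
Qed.

Lemma root_between es fs (a b : R) :
  (forall x, (\prod_(e <- es) (x - e)) ^+ 2 - 4 = \prod_(f <- fs) (x - f)) ->
  a \in es -> b \in es -> a < b -> exists2 f, f \in fs & a < f < b.
Proof.
move=> DP ae be ab; pose D x := \prod_(e <- es) (x - e).
pose P x := \prod_(f <- fs) (x - f).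
have {DP}DP x : D x ^+ 2 - 4 = P x by apply: DP.
have root0 e : e \in es -> D e = 0.
  by move=> ee; rewrite /D (big_rem e)//= subrr mul0r.
have fs0 : fs != [::].
  apply/eqP => fs0; have := DP a; rewrite root0// /P fs0 big_nil; lra.
have Droot x : P x = 0 -> x \in fs.
  move/eqP; rewrite /P prodf_seq_eq0 => /hasP[f ff]; rewrite subr_eq0 /=.
  by move=> /eqP ->.
have [y yab Dy] : exists2 y, a < y < b & 4 <= D y ^+ 2.
  (* Otherwise [4 - D^2] would have a local minimum inside [a, b], against
     [prod_gap_lt]. *)
  apply: contrapT => small.
  have {}small y : a < y < b -> D y ^+ 2 < 4.
    by move=> yab; rewrite ltNge; apply/negP => ?; apply: small; exists y.
  have cD : continuous (fun x => D x ^+ 2).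
    move=> x; apply: continuousM; exact: continuous_prod_sub.
  have [x0 x0ab x0max] := EVT_max (ltW ab) (continuous_subspaceT cD).
  (* The maximum is attained inside: [D] vanishes at both ends, so an end can be a maximizer only if
     [D] vanishes throughout, and then the midpoint serves. *)
  have [x1 x1ab x1max] : exists2 x1, a < x1 < b & forall y, a < y < b -> D y ^+ 2 <= D x1 ^+ 2.
    have [D0|D0] := eqVneq (D x0) 0.
      exists ((a + b) / 2); first by lra.
      move=> y yab; apply: (@le_trans _ _ (D x0 ^+ 2)); last by rewrite D0 expr0n sqr_ge0.
      by apply: x0max; rewrite in_itv/=; lra.
    exists x0.
      move: x0ab; rewrite in_itv/= !le_eqVlt => /andP[/predU1P[ax|->] /predU1P[xb|->]] //.
      - by move: ab; rewrite ax xb ltxx.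
      - by move: D0; rewrite -ax root0 ?eqxx.
      - by move: D0; rewrite xb root0 ?eqxx.
    by move=> y yab; apply: x0max; rewrite in_itv/=; lra.
  have P1 : `|P x1| = 4 - D x1 ^+ 2.
    by rewrite -DP ltr0_norm ?opprB// subr_lt0 small.
  have xs f : f \in fs -> x1 != f.
    move=> ff; apply/eqP => x1f; have := small _ x1ab.
    have := DP x1; have -> : P x1 = 0 by rewrite /P (big_rem f)//= x1f subrr mul0r.
    lra.
  have [t0 t0_gt0 tP] := prod_gap_lt fs0 xs.
  have [t t_gt0 tlt] : exists2 t : R, 0 < t & {in [:: t0; x1 - a; b - x1], forall d, t < d}.
    by apply: small_below_all => d; rewrite !inE => /or3P[]/eqP ->; lra.
  have t1 : t < t0 by apply: tlt; rewrite !inE eqxx.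
  have t2 : t < x1 - a by apply: tlt; rewrite !inE eqxx orbT.
  have t3 : t < b - x1 by apply: tlt; rewrite !inE eqxx !orbT.
  have := tP t; rewrite t_gt0 t1 => /(_ isT); rewrite ltNge => /negP; apply.
  rewrite -/(P _) -/(P _) -/(P _) normrM expr2.
  have lem y : a < y < b -> `|P x1| <= `|P y|.
    move=> yab; have Py : `|P y| = 4 - D y ^+ 2.
      by rewrite -DP ltr0_norm ?opprB// subr_lt0 small.
    by rewrite P1 Py lerD2l lerN2 x1max.
  by rewrite ler_pM//; apply: lem; lra.
(* [P] equals -4 at [a] and is nonnegative at [y], so it has a zero in between. *)
have cP : continuous P by exact: continuous_prod_sub.
have ay : a <= y by lra.
have := @IVT R P a y 0 ay (continuous_subspaceT cP).
rewrite -!DP root0// => [][|c cay].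
  rewrite ge_min le_max; apply/andP; split; apply/orP; [left|right]; lra.
move=> Pc; exists c; first exact: Droot.
move: cay; rewrite in_itv/= le_eqVlt => /andP[/predU1P[ac|ac] cy]; last by lra.
by move: Pc; rewrite -DP -ac root0//; lra.
Qed.

(** Applying [root_between] to consecutive zeros of the product [D] over [es] yields one zero of
    [D ^+ 2 - 4] per gap; enclosing each between two given zeros keeps it inside the same
    cluster. *)
Lemma roots_interlace es fs (s : seq R) (x : R) :
  (forall x, (\prod_(e <- es) (x - e)) ^+ 2 - 4 = \prod_(f <- fs) (x - f)) ->
  path <%R x s -> {subset x :: s <= es} ->
  exists t : seq R, [/\ path <%R x t, size t = size s, {subset t <= fs} &
    {in t, forall z, exists a b, [/\ a \in x :: s, b \in x :: s & a < z < b]}].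
Proof.
move=> DP; elim: s x => [|y s IH] x /=; first by exists [::].
move=> /andP[xy ys] sub.
have [|t [yt st tfs tb]] := IH _ ys.
  by move=> z zs; apply: sub; rewrite in_cons zs orbT.
have [f ff /andP[xf fy]] : exists2 f, f \in fs & x < f < y.
  by apply: (root_between DP) => //; apply: sub; rewrite !inE eqxx ?orbT.
exists (f :: t); split => /=.
- rewrite xf; apply: path_le yt => //; exact: lt_trans.
- by rewrite st.
- by move=> z; rewrite in_cons => /predU1P[->|/tfs].
- move=> z; rewrite in_cons => /predU1P[->|/tb [a [b [aa bb zab]]]].
    by exists x, y; rewrite !inE !eqxx !orbT xf fy.
  by exists a, b; rewrite in_cons aa orbT in_cons bb orbT.
Qed.

(** A zero within [2 * h] of [x] has [h ^+ 2 >= (x - e) ^+ 2 / 4], whence a factor 5/4; the other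
    factors only grow when [h ^+ 2] is added. *)
Lemma prod_height_ge (s t : seq R) (x h : R) :
  uniq t -> {subset t <= s} -> {in t, forall e, `|x - e| <= 2 * h} ->
  (5 / 4) ^+ size t * (\prod_(e <- s) (x - e)) ^+ 2
    <= \prod_(e <- s) ((x - e) ^+ 2 + h ^+ 2).
Proof.
move=> ut ts tb; pose near e := `|x - e| <= 2 * h.
have st : (size t <= count near s)%N.
  rewrite -size_filter; apply: uniq_leq_size => // e et.
  by rewrite mem_filter ts// andbT; apply: tb.
apply: (@le_trans _ _ ((5 / 4) ^+ count near s * (\prod_(e <- s) (x - e)) ^+ 2)).
  rewrite ler_wpM2r ?sqr_ge0// ler_weXn2l//; lra.
elim: s {ts st} => [|e s IH]; first by rewrite !big_nil expr0 expr1n mulr1.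
rewrite !big_cons /= exprD [((x - e) * _) ^+ 2]exprMn mulrACA; apply: ler_pM; last exact: IH.
- by rewrite mulr_ge0 ?sqr_ge0// exprn_ge0//; lra.
- by rewrite mulr_ge0 ?sqr_ge0// exprn_ge0//; lra.
rewrite /near; case: (leP `|x - e| (2 * h)) => [le|_]; last first.
  by rewrite expr0 mul1r lerDl sqr_ge0.
rewrite [nat_of_bool _]/= expr1.
have : (x - e) ^+ 2 <= (2 * h) ^+ 2.
  rewrite -(real_normK (num_real (x - e))) ler_pXn2r ?nnegrE//.
  by apply: le_trans le.
by nra.
Qed.

Lemma trace_height_ge es fs (n : nat) (eps h x : R) :
  (forall x, (\prod_(e <- es) (x - e)) ^+ 2 - 4 = \prod_(f <- fs) (x - f)) ->
  (forall x h, \prod_(f <- fs) ((x - f) ^+ 2 + h ^+ 2)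
     <= (\prod_(e <- es) ((x - e) ^+ 2 + h ^+ 2) + 4) ^+ 2) ->
  es != [::] ->
  {in es, forall e, exists s : seq R, [/\ uniq s, (n < size s)%N, {subset s <= es} &
     {in s, forall e', `|e' - e| <= eps}]} ->
  0 < h -> eps <= h ->
  4 * (5 / 4) ^+ n <= (\prod_(e <- es) ((x - e) ^+ 2 + h ^+ 2) + 4) ^+ 2.
Proof.
move=> DP DPh es0 cl h0 eh.
have [x0 le0 [e ee xe]] := @min_height_near_root es h x es0 h0.
set F := \prod_(e <- es) _ in le0 *.
apply: (@le_trans _ _ ((F + 4) ^+ 2)); last first.
  have F0 : 0 <= F by apply: prodr_ge0 => ? _; rewrite addr_ge0 ?sqr_ge0.
  by rewrite ler_pXn2r// ?nnegrE ?lerD2r// addr_ge0// (le_trans F0).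
have [s [us ns se sb]] := cl _ ee.
have sb2 : {in s, forall z, `|x0 - z| <= 2 * h}.
  move=> z zs; have -> : x0 - z = (x0 - e) - (z - e) by ring.
  apply: le_trans (ler_normB _ _) _; have := sb _ zs; lra.
(* If [D ^+ 2 >= 2] at [x0], the zeros of [D] in the cluster give the growth. Otherwise
   [|D ^+ 2 - 4| > 2] there, and the interlacing zeros of [D ^+ 2 - 4] give it. *)
have [big|small] := leP 2 ((\prod_(e <- es) (x0 - e)) ^+ 2).
  have := prod_height_ge us se sb2; rewrite -/F => hF.
  have hn : (5 / 4) ^+ n <= (5 / 4 : R) ^+ size s by rewrite ler_weXn2l//; [lra|apply: ltnW].
  have n1 : 1 <= (5 / 4 : R) ^+ n by rewrite exprn_ege1//; lra.
  have : 2 * (5 / 4) ^+ n <= F.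
    apply: le_trans hF; rewrite mulrC ler_pM//.
  by nra.
pose s' := sort <=%R s.
have [y [t [ys yt]]] : exists y t, s' = y :: t /\ path <%R y t.
  have : sorted <%R s' by rewrite lt_sorted_uniq_le sort_le_sorted sort_uniq us.
  have : size s' = size s by rewrite size_sort.
  case: s' => [|y t] /=; first by move=> s0; move: ns; rewrite -s0.
  by move=> _ yt; exists y, t.
have ms' : s' =i s by move=> z; rewrite mem_sort.
have [|t' [yt' st' t'fs t'b]] := roots_interlace DP yt.
  by rewrite -ys => z; rewrite ms' => /se.
have t'n : (n <= size t')%N by rewrite st' -ltnS -[(size t).+1]/(size (y :: t)) -ys size_sort.
have ut' : uniq t'.
  have : sorted <%R (y :: t') by [].
  by rewrite lt_sorted_uniq_le => /andP[/= /andP[]].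
have : {in t', forall z, `|x0 - z| <= 2 * h}.
  move=> z /t'b[a [b []]]; rewrite -ys !ms' => /sb2 ha /sb2 hb.
  by move: ha hb; rewrite !ler_norml; lra.
move=> /(prod_height_ge ut' t'fs) hP.
apply: le_trans (DPh _ _); apply: le_trans hP.
rewrite -DP mulrC; set d := _ ^+ 2 in small *.
have hn : (5 / 4) ^+ n <= (5 / 4 : R) ^+ size t' by rewrite ler_weXn2l//; lra.
have d0 : 0 <= d by exact: sqr_ge0.
apply: ler_pM => //; nra.
Qed.

End TraceLowerBound.

(** * A sum over ordinals and the squared modulus of a complex number *)

Lemma sum_pick_ord (T : nmodType) (q : nat) (F : nat -> T) (n : nat) :
  \sum_(i < q) F i *+ (i == n :> nat) = if (n < q)%N then F n else 0.
Proof.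
rewrite -(@big_ord1_eq _ 0 +%R) [RHS]big_mkcond.
by apply: eq_bigr => i _; case: eqP.
Qed.

Section SquaredModulus.
Variable R : rcfType.
Implicit Types (z w : R[i]).

(** Real-valued, unlike the norm of [R[i]], and polynomial in the two coordinates, so that
    identities are within reach of [ring]. *)
Definition sqn z : R := complex.Re z ^+ 2 + complex.Im z ^+ 2.

Lemma sqn_ge0 z : 0 <= sqn z. Proof. by rewrite addr_ge0 ?sqr_ge0. Qed.

Lemma sqn0 : sqn 0 = 0. Proof. by rewrite /sqn /= expr0n addr0. Qed.

Lemma sqn_eq0 z : (sqn z == 0) = (z == 0).
Proof. by rewrite paddr_eq0 ?sqr_ge0// !sqrf_eq0 eq_complex. Qed.

Lemma sqnM z w : sqn (z * w) = sqn z * sqn w.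
Proof. by case: z => a b; case: w => c d; rewrite /sqn /=; ring. Qed.

Lemma sqn_prod (I : Type) (s : seq I) (F : I -> R[i]) :
  sqn (\prod_(i <- s) F i) = \prod_(i <- s) sqn (F i).
Proof.
elim: s => [|i s IH]; last by rewrite !big_cons sqnM IH.
by rewrite !big_nil /sqn /=; ring.
Qed.

Lemma sqnN z : sqn (- z) = sqn z.
Proof. by case: z => a b; rewrite /sqn /=; ring. Qed.

Lemma sqn_real (x : R) : sqn x%:C = x ^+ 2.
Proof. by rewrite /sqn /= expr0n addr0. Qed.

Lemma sqnV z : sqn z^-1 = (sqn z)^-1.
Proof.
have [->|z0] := eqVneq z 0; first by rewrite invr0 sqn0 invr0.
apply: (mulfI (x := sqn z)); first by rewrite sqn_eq0.
by rewrite -sqnM !divff ?sqn_eq0// sqn_real expr1n.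
Qed.

Lemma sqnD z w : sqn (z + w) <= 2 * sqn z + 2 * sqn w.
Proof.
case: z => a b; case: w => c d; rewrite /sqn /= -subr_ge0.
set e := (X in 0 <= X); have -> : e = (a - c) ^+ 2 + (b - d) ^+ 2 by rewrite /e; ring.
by rewrite addr_ge0 ?sqr_ge0.
Qed.

Lemma normc_sqr z : Normc.normc z ^+ 2 = sqn z.
Proof. by case: z => a b; rewrite /= sqr_sqrtr ?addr_ge0 ?sqr_ge0. Qed.

Lemma sqn_norm z : (sqn z)%:C = `|z| ^+ 2.
Proof. exact: add_Re2_Im2. Qed.

Lemma sqr_ImM z w : complex.Im (z * conjc w) ^+ 2 <= sqn z * sqn w.
Proof.
case: z => a b; case: w => c d; rewrite /sqn /= -subr_ge0.
set e := (X in 0 <= X); have -> : e = (a * c + b * d) ^+ 2 by rewrite /e; ring.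
exact: sqr_ge0.
Qed.

(* The Hermitian form sending (a, b) to the imaginary part of [a] times the
   conjugate of [b] has signature (1, 1), so the Cauchy-Schwarz inequality is
   reversed. *)
Lemma reverse_cauchy_schwarz (a b c d : R[i]) :
  4 * complex.Im (a * conjc b) * (- complex.Im (c * conjc d)) <= sqn (a * d - b * c).
Proof.
rewrite -subr_ge0.
have -> : sqn (a * d - b * c) - 4 * complex.Im (a * conjc b) * (- complex.Im (c * conjc d))
   = sqn (a * conjc d - b * conjc c).
  case: a => a1 a2; case: b => b1 b2; case: c => c1 c2; case: d => d1 d2.
  rewrite /sqn /=; ring.
exact: sqn_ge0.
Qed.

Lemma sqn_sqrB4 z : sqn (z ^+ 2 - 4) <= (sqn z + 4) ^+ 2.
Proof.
rewrite -subr_ge0.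
have -> : (sqn z + 4) ^+ 2 - sqn (z ^+ 2 - 4) = 16 * complex.Re z ^+ 2.
  have -> : 4 = (4%:R : R)%:C by rewrite rmorph_nat.
  case: z => a b; rewrite expr2 /sqn /=; ring.
by rewrite mulr_ge0 ?sqr_ge0.
Qed.

End SquaredModulus.

(** * Solutions of the three-term recurrence and the trace polynomial *)

Section Recurrence.
Variable R : realType.
Variable V : nat -> R.
Implicit Types (z : R[i]) (u w : nat -> R[i]).

(** The equation is imposed at the sites 1 to [N] and so involves [u 0] up to [u N.+1]; here the
    value at 0 is a genuine boundary value. *)
Definition solves z u N := forall m, (m < N)%N ->
  u m.+2 + u m + (V m.+1)%:C * u m.+1 = z * u m.+1.

Lemma solvesE z u N m : solves z u N -> (m < N)%N ->
  u m.+2 = (z - (V m.+1)%:C) * u m.+1 - u m.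
Proof. by move=> su mN; rewrite mulrBl -(su _ mN); ring. Qed.

Lemma solves_comb z u w a b N : solves z u N -> solves z w N ->
  solves z (fun n => a * u n + b * w n) N.
Proof.
move=> su sw m mN /=; rewrite (solvesE su mN) (solvesE sw mN); ring.
Qed.

Lemma solves_unique z u w N : solves z u N -> solves z w N ->
  u 0%N = w 0%N -> u 1%N = w 1%N -> forall n, (n <= N.+1)%N -> u n = w n.
Proof.
move=> su sw uw0 uw1.
suff : forall n, ((n <= N.+1)%N -> u n = w n) /\ ((n.+1 <= N.+1)%N -> u n.+1 = w n.+1).
  by move=> h n; have [] := h n.
elim=> [|n [IH1 IH2]]; first by split.
split; first exact: IH2.
rewrite ltnS => nN; rewrite (solvesE su nN) (solvesE sw nN).
by rewrite IH1 ?IH2// ltnW// ltnW.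
Qed.

Definition flux u n : R := complex.Im (u n.+1 * conjc (u n)).

(** The potential contributes the real number [V |u|^2], and [- u_m] times the conjugate of
    [u_{m+1}] has the imaginary part of the previous flux. *)
Lemma fluxS z u N m : solves z u N -> (m < N)%N ->
  flux u m.+1 = flux u m + complex.Im z * sqn (u m.+1).
Proof.
move=> su mN; rewrite /flux (solvesE su mN).
case: (u m.+1) => a b; case: (u m) => c d; case: z {su} => x y.
by rewrite /sqn /=; ring.
Qed.

Lemma flux_sum z u N m n : solves z u N -> (m <= n <= N)%N ->
  flux u n = flux u m + complex.Im z * \sum_(m <= j < n) sqn (u j.+1).
Proof.
move=> su /andP[mn]; elim: n mn => [|n IH].
  by rewrite leqn0 => /eqP -> _; rewrite big_geq// mulr0 addr0.
rewrite leq_eqVlt => /predU1P[-> _|]; first by rewrite big_geq// mulr0 addr0.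
rewrite ltnS => mn nN; rewrite (fluxS su nN) (IH mn (ltnW nN)).
by rewrite big_nat_recr//=; ring.
Qed.

Lemma wronskian_const z u w N n : solves z u N -> solves z w N -> (n <= N)%N ->
  u n.+1 * w n - u n * w n.+1 = u 1%N * w 0%N - u 0%N * w 1%N.
Proof.
move=> su sw; elim: n => // n IH nN.
rewrite -(IH (ltnW nN)) (solvesE su nN) (solvesE sw nN); ring.
Qed.

(** The pair holds the values at [n] and [n.+1] of the solution starting with [a], [b] at 0 and 1,
    as polynomials in the spectral parameter. *)
Fixpoint fundsol (a b : {poly R[i]}) n : {poly R[i]} * {poly R[i]} :=
  if n is m.+1 then
    let uu := fundsol a b m in
    (uu.2, ('X - ((V m.+1)%:C)%:P) * uu.2 - uu.1)
  else (a, b).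

Definition dirichlet n := (fundsol 0 1 n).1.
Definition neumann n := (fundsol 1 0 n).1.
(* The trace of the transfer matrix over [q] sites. *)
Definition trace_poly q := dirichlet q.+1 + neumann q.

Lemma dirichletSS n :
  dirichlet n.+2 = ('X - ((V n.+1)%:C)%:P) * dirichlet n.+1 - dirichlet n.
Proof. by []. Qed.

Lemma neumannSS n :
  neumann n.+2 = ('X - ((V n.+1)%:C)%:P) * neumann n.+1 - neumann n.
Proof. by []. Qed.

Lemma dirichlet0 z : (dirichlet 0).[z] = 0. Proof. exact: horner0. Qed.

Lemma dirichlet1 z : (dirichlet 1).[z] = 1. Proof. exact: hornerC. Qed.

Lemma neumann0 z : (neumann 0).[z] = 1. Proof. exact: hornerC. Qed.

Lemma neumann1 z : (neumann 1).[z] = 0. Proof. exact: horner0. Qed.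

Lemma solves_dirichlet z N : solves z (fun n => (dirichlet n).[z]) N.
Proof. by move=> m _; rewrite dirichletSS !hornerE; ring. Qed.

Lemma solves_neumann z N : solves z (fun n => (neumann n).[z]) N.
Proof. by move=> m _; rewrite neumannSS !hornerE; ring. Qed.

Lemma size_dirichlet n : size (dirichlet n.+1) = n.+1 /\ dirichlet n.+1 \is monic.
Proof.
suff : [/\ (size (dirichlet n) <= n)%N, size (dirichlet n.+1) = n.+1 &
         dirichlet n.+1 \is monic] by case.
elim: n => [|n [IH1 IH2 IH3]].
  have [-> ->] : dirichlet 0 = 0 /\ dirichlet 1 = 1 by [].
  by rewrite size_poly0 size_poly1 monic1.
have sXd : size (('X - ((V n.+1)%:C)%:P) * dirichlet n.+1) = n.+2.
  by rewrite size_monicM ?monicXsubC// -?size_poly_eq0 ?IH2// size_XsubC.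
have lt : (size (- dirichlet n)%R < size (('X - ((V n.+1)%:C)%:P) * dirichlet n.+1)%R)%N.
  by rewrite sXd size_polyN ltnS (leq_trans IH1).
split; first by rewrite IH2.
  by rewrite dirichletSS size_polyDl.
by rewrite dirichletSS monicE lead_coefDl// -monicE monicMl ?monicXsubC.
Qed.

Lemma size_neumann n : (size (neumann n.+1) <= n)%N.
Proof.
suff : (size (neumann n.+1) <= n)%N /\ (size (neumann n.+2) <= n.+1)%N by case.
elim: n => [|n [IH1 IH2]].
  rewrite neumannSS /neumann /= size_poly0 mulr0 add0r size_polyN size_poly1//.
split=> //; rewrite neumannSS (leq_trans (size_polyD _ _))// size_polyN geq_max.
rewrite (leq_trans IH1) ?andbT; last by rewrite (leq_trans (leqnSn _)).
by rewrite (leq_trans (size_polyMleq _ _))// size_XsubC add2n /= ltnS.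
Qed.

Opaque dirichlet neumann.

Lemma trace_monic (q : nat) (c : R[i]) : (0 < q)%N ->
  size (trace_poly q - c%:P) = q.+1 /\ trace_poly q - c%:P \is monic.
Proof.
case: q => // q _; have [sD mD] := size_dirichlet q.+1.
have lt : (size (neumann q.+1 - c%:P)%R < size (dirichlet q.+2))%N.
  rewrite sD ltnS (leq_trans (size_polyD _ _))// size_polyN geq_max.
  rewrite (leq_trans (size_neumann _))//=.
  by rewrite (leq_trans (size_polyC_leq1 _)).
rewrite /trace_poly -addrA size_polyDl// sD; split => //.
by rewrite monicE lead_coefDl.
Qed.

Lemma wronskian_fundamental z n :
  (dirichlet n.+1).[z] * (neumann n).[z] - (dirichlet n).[z] * (neumann n.+1).[z] = 1.
Proof.
rewrite (wronskian_const (@solves_dirichlet z n) (@solves_neumann z n))//.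
by rewrite !(dirichlet0, dirichlet1, neumann0, neumann1); ring.
Qed.

Lemma solves_fundamental z u N : solves z u N -> forall n, (n <= N.+1)%N ->
  u n = u 1%N * (dirichlet n).[z] + u 0%N * (neumann n).[z].
Proof.
move=> su; apply: (solves_unique su).
- exact: (solves_comb _ _ (@solves_dirichlet z N) (@solves_neumann z N)).
- by rewrite !(dirichlet0, dirichlet1, neumann0, neumann1); ring.
- by rewrite !(dirichlet0, dirichlet1, neumann0, neumann1); ring.
Qed.

Lemma resolvent_dirichlet z (g : nat -> R[i]) (N L : nat) :
  0 < complex.Im z -> solves z g L -> g 0%N = -1 -> g L.+1 = 0 -> (N <= L)%N ->
  4 * complex.Im z ^+ 2 * (\sum_(0 <= j < N) sqn (dirichlet j.+1).[z])
    * (\sum_(N <= j < L) sqn (g j.+1)) <= 1.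
Proof.
(* The two fluxes at [N] have opposite signs and the Wronskian is [-1]. *)
move=> h0 sg g0 gL NL.
have fg : flux g L = 0 by rewrite /flux gL mul0r.
have NLL : (N <= L <= L)%N by rewrite NL leqnn.
have := flux_sum sg NLL; rewrite fg => /eqP; rewrite eq_sym addr_eq0 => /eqP fgN.
have fp := flux_sum (@solves_dirichlet z N) (leqnn N : (0 <= N <= N)%N).
have fp0 : flux (fun n => (dirichlet n).[z]) 0 = 0.
  by rewrite /flux dirichlet0 conjc0 mulr0.
rewrite fp0 add0r in fp.
have := reverse_cauchy_schwarz (dirichlet N.+1).[z] (dirichlet N).[z] (g N.+1) (g N).
rewrite -/(flux (fun n => (dirichlet n).[z]) N) -/(flux g N) fp fgN opprK.
rewrite (wronskian_const (@solves_dirichlet z L) sg NL) g0.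
rewrite dirichlet0 dirichlet1 mul0r subr0 mul1r.
have -> : sqn (-1 : R[i]) = 1 by rewrite sqnN sqn_real expr1n.
set P := \sum_(0 <= j < N) _; set G := \sum_(N <= j < L) _.
by apply: le_trans; rewrite le_eqVlt; apply/orP; left; apply/eqP; ring.
Qed.

Section FundamentalPair.
Variables (z : R[i]) (a b : nat -> R[i]).
Hypothesis sa : forall N, solves z a N.
Hypothesis sb : forall N, solves z b N.
Hypotheses (a0 : a 0%N = 0) (a1 : a 1%N = 1) (b0 : b 0%N = 1) (b1 : b 1%N = 0).
Hypothesis z_gt0 : 0 < complex.Im z.

(** The solution [u] vanishing at [q] with [u 0 = a q] and [u 1 = - b q] has no flux at its right
    end. So its flux at 0, of modulus at most [|a q| |b q|], equals up to sign [Im z] times a sum of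
    squares that contains [|b q| ^ 2]. *)
Lemma neumann_le_dirichlet q : (0 < q)%N ->
  complex.Im z ^+ 2 * sqn (b q) <= sqn (a q).
Proof.
move: z_gt0; set h := complex.Im z => h0; case: q => // -[|q] _.
  by rewrite b1 sqn0 mulr0 sqn_ge0.
pose u n := a q.+2 * b n + (- b q.+2) * a n.
have su : solves z u q.+1 by exact: (solves_comb _ _ (@sb q.+1) (@sa q.+1)).
have uq : u q.+2 = 0 by rewrite /u; ring.
have u0 : u 0%N = a q.+2 by rewrite /u a0 b0; ring.
have u1 : u 1%N = - b q.+2 by rewrite /u a1 b1; ring.
have := flux_sum su (leqnn q.+1 : (0 <= q.+1 <= q.+1)%N).
rewrite {1}/flux uq mul0r [complex.Im 0]/= big_nat_recl//= => /eqP.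
rewrite eq_sym addr_eq0 {1}/flux u1 u0 sqnN -/h => /eqP f.
have S0 : 0 <= \sum_(0 <= i < q) sqn (u i.+2) by apply: sumr_ge0 => *; exact: sqn_ge0.
have := sqr_ImM (- b q.+2) (a q.+2); rewrite sqnN f sqrrN => le.
have {}le : (h * sqn (b q.+2)) ^+ 2 <= sqn (b q.+2) * sqn (a q.+2).
  have sr0 := sqn_ge0 (b q.+2); have A := mulr_ge0 (ltW h0) sr0.
  have B := mulr_ge0 (ltW h0) (addr_ge0 sr0 S0).
  apply: le_trans le; rewrite ler_pXn2r ?nnegrE//.
  by rewrite ler_pM2l// lerDl.
have [->|rN0] := eqVneq (sqn (b q.+2)) 0; first by rewrite mulr0 sqn_ge0.
have r0 : 0 < sqn (b q.+2) by rewrite lt_neqAle eq_sym rN0 sqn_ge0.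
rewrite -(ler_pM2l r0); apply: le_trans le.
by rewrite le_eqVlt; apply/orP; left; apply/eqP; ring.
Qed.

(** Only [a q] and [a q.+1] from the sum matter: [neumann_le_dirichlet] trades [b q] for [a q]. This
    lets the trace replace the Dirichlet sum in [resolvent_dirichlet]. *)
Lemma trace_le_dirichlet q : (0 < q)%N ->
  complex.Im z ^+ 2 * sqn (a q.+1 + b q)
    <= 2 * (1 + complex.Im z ^+ 2) * \sum_(0 <= j < q.+1) sqn (a j.+1).
Proof.
move=> q0; have := neumann_le_dirichlet q0; have := sqnD (a q.+1) (b q).
case: q q0 => // q _; rewrite big_nat_recr//= big_nat_recr//=.
have : 0 <= \sum_(0 <= j < q) sqn (a j.+1) by apply: sumr_ge0 => *; exact: sqn_ge0.
have := sqn_ge0 (a q.+1); have := sqn_ge0 (a q.+2).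
have : 0 <= complex.Im z ^+ 2 by exact: sqr_ge0.
move: (sqn (a q.+2)) (sqn (a q.+1)) (sqn (b q.+1)) (sqn (_ + _)) => A B C D.
move: (complex.Im z ^+ 2) (\sum_(0 <= j < q) _) => h S hh A0 B0 S0 dle cle.
have : h * D <= 2 * (h * A + h * C) by rewrite -mulrDr mulrCA ler_wpM2l//; lra.
nra.
Qed.

End FundamentalPair.

Lemma resolvent_trace z (g : nat -> R[i]) (q L : nat) :
  0 < complex.Im z -> (0 < q)%N -> solves z g L -> g 0%N = -1 -> g L.+1 = 0 ->
  (q < L)%N ->
  2 * complex.Im z ^+ 4 * sqn (trace_poly q).[z] * \sum_(q.+1 <= j < L) sqn (g j.+1)
    <= 1 + complex.Im z ^+ 2.
Proof.
move=> h0 q0 sg g0 gL qL.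
have := resolvent_dirichlet h0 sg g0 gL qL.
have := trace_le_dirichlet (@solves_dirichlet z) (@solves_neumann z) (dirichlet0 z)
  (dirichlet1 z) (neumann0 z) (neumann1 z) h0 q0.
rewrite -hornerD -/(trace_poly q).
set P := \sum_(0 <= j < _) _; set G := \sum_(_ <= j < L) _; set D := sqn _.
have G0 : 0 <= G by apply: sumr_ge0 => *; exact: sqn_ge0.
have -> : complex.Im z ^+ 4 = (complex.Im z ^+ 2) ^+ 2 by ring.
have : 0 < complex.Im z ^+ 2 by exact: exprn_gt0.
set h := complex.Im z ^+ 2 => hh DP PG.
have : (h * D) * (2 * h * G) <= (2 * (1 + h) * P) * (2 * h * G).
  by rewrite ler_wpM2r// !mulr_ge0// ltW.
have : (1 + h) * (4 * h * P * G) <= (1 + h) * 1 by rewrite ler_wpM2l//; lra.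
nra.
Qed.

(** At a zero the flux would vanish at both ends, forcing the whole sum of squares to be 0, although
    its first term is 1. *)
Lemma dirichlet_neq0 z q : complex.Im z != 0 -> (0 < q)%N -> (dirichlet q).[z] != 0.
Proof.
move=> h0 q0; apply/eqP => p0; case: q q0 p0 => // q _ p0.
have sp := @solves_dirichlet z q.+1.
have := flux_sum sp (leqnn q.+1 : (0 <= q.+1 <= q.+1)%N).
rewrite {1}/flux p0 conjc0 mulr0 /flux dirichlet0 conjc0 mulr0 [complex.Im 0]/= add0r.
move/eqP; rewrite eq_sym mulf_eq0 (negPf h0)/= => /eqP.
rewrite big_nat_recl//= dirichlet1 sqn_real => S0.
have : 0 <= \sum_(0 <= i < q) sqn (dirichlet i.+2).[z] by apply: sumr_ge0 => *; exact: sqn_ge0.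
by move: S0; lra.
Qed.

(** The transfer matrix has determinant 1 and trace [tau + tau^-1], hence the eigenvalue [tau^-1];
    an eigenvector provides the initial values of [u]. *)
Lemma solves_quasiperiodic z q tau : (0 < q)%N -> tau != 0 ->
  (trace_poly q).[z] = tau + tau^-1 ->
  tau ^+ 2 != 1 \/ (dirichlet q).[z] != 0 ->
  exists u, [/\ solves z u q, u 0%N = tau * u q, u 1%N = tau * u q.+1 &
     (u 0%N, u 1%N) != (0, 0)].
Proof.
move=> q0 t0; rewrite /trace_poly hornerD => Dt ndeg.
have wr := wronskian_fundamental z q.
set p := (dirichlet q).[z] in ndeg wr *; set r := (neumann q).[z] in wr Dt *.
set p' := (dirichlet q.+1).[z] in wr Dt *; set r' := (neumann q.+1).[z] in wr.
have det : (1 - tau * r) * (1 - tau * p') - tau ^+ 2 * p * r' = 0.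
  have -> : (1 - tau * r) * (1 - tau * p') - tau ^+ 2 * p * r'
     = 1 - tau * (p' + r) + tau ^+ 2 * (p' * r - p * r') by ring.
  by rewrite wr Dt mulrDr divff//; ring.
suff [a [b [e1 e2 ab]]] : exists a b, [/\ b = tau * (a * p + b * r),
    a = tau * (a * p' + b * r') & (b, a) != (0, 0)].
  exists (fun n => a * (dirichlet n).[z] + b * (neumann n).[z]).
  split=> //.
  - exact: (solves_comb _ _ (@solves_dirichlet z q) (@solves_neumann z q)).
  - by rewrite !(dirichlet0, dirichlet1, neumann0, neumann1) !(mulr0, mulr1, addr0, add0r).
  - by rewrite !(dirichlet0, dirichlet1, neumann0, neumann1) !(mulr0, mulr1, addr0, add0r).
  - by rewrite !(dirichlet0, dirichlet1, neumann0, neumann1) !(mulr0, mulr1, addr0, add0r).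
(* A kernel vector of the singular matrix is read off its first row. If that row is zero, then
   [p = 0] and [p' = tau], and the second row is used; [tau ^+ 2 != 1] makes it nonzero. *)
have [/eqP|nz] := boolP ((tau * p, 1 - tau * r) == (0, 0)).
  move=> -[/eqP]; rewrite mulf_eq0 (negPf t0)/= => /eqP p0.
  move=> /eqP; rewrite subr_eq0 => /eqP r1.
  have rt : r = tau^-1 by rewrite -[LHS](mulKf t0) -r1 mulr1.
  have p't : p' = tau by apply: (addIr r); rewrite Dt rt.
  exists (tau * r'), (1 - tau * p'); rewrite p0 p't mulr0 add0r; split.
  - by rewrite mulrCA -r1 mulr1.
  - by ring.
  - apply/eqP => -[/eqP]; rewrite subr_eq0 => /eqP t1 _.
    by case: ndeg; rewrite ?p0 ?eqxx// expr2 -t1 eqxx.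
exists (1 - tau * r), (tau * p); split => //; first by ring.
by apply/eqP; rewrite -subr_eq0 -det; apply/eqP; ring.
Qed.

(** A multiplier of modulus one makes the fluxes at 0 and at [q] equal, so [Im z] times the sum of
    squares of a nonzero solution vanishes. *)
Lemma trace_real_root z q tau : (0 < q)%N -> sqn tau = 1 ->
  (trace_poly q).[z] = tau + tau^-1 -> complex.Im z = 0.
Proof.
move=> q0 t1 Dt; apply/eqP; apply: contrapT => /negP z0.
have t0 : tau != 0 by rewrite -sqn_eq0 t1 oner_eq0.
have [u [su u0 u1 unz]] := solves_quasiperiodic q0 t0 Dt (or_intror (dirichlet_neq0 z0 q0)).
have := flux_sum su (leqnn q : (0 <= q <= q)%N).
have -> : flux u q = flux u 0.
  rewrite /flux u0 u1; move: t1; rewrite /sqn.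
  case: (tau) => a b /=; case: (u q) => c d; case: (u q.+1) => e f /= t1.
  transitivity ((a ^+ 2 + b ^+ 2) * (f * c - e * d)); first by rewrite t1; ring.
  by ring.
move/eqP; rewrite eq_sym -subr_eq0 addrAC subrr add0r mulf_eq0 (negPf z0) /=.
rewrite psumr_eq0 => [/allP uz|*]; last exact: sqn_ge0.
have {}uz j : (j < q)%N -> u j.+1 = 0.
  by move=> jq; apply/eqP; rewrite -sqn_eq0; apply: uz; rewrite mem_index_iota.
have uq : u q = 0 by rewrite -(prednK q0) uz// prednK.
by move: unz; rewrite u0 uq mulr0 uz// eqxx.
Qed.

End Recurrence.

(** * Real zeros of the trace and the eigenvalues of the periodic matrix *)

Section Zeros.
Variable R : realType.
Variable V : nat -> R.

Lemma real_split (P : {poly R[i]}) : P \is monic ->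
  (forall z, P.[z] = 0 -> complex.Im z = 0) ->
  exists2 es : seq R, size P = (size es).+1 &
    P = \prod_(e <- es) ('X - (e%:C)%:P).
Proof.
move=> mP rP; have [rs Prs] := closed_field_poly_normal P.
rewrite (monicP mP) scale1r in Prs.
have rsE : rs = [seq (complex.Re z)%:C | z <- rs].
  rewrite -[LHS]map_id; apply/eq_in_map => z zrs; rewrite [LHS]complexE rP ?mulr0 ?addr0//.
  by apply/eqP; rewrite -/(root P z) Prs root_prod_XsubC.
exists [seq complex.Re z | z <- rs].
  by rewrite Prs size_prod_XsubC size_map.
by rewrite [LHS]Prs rsE !big_map; apply: eq_bigr.
Qed.

Lemma sqn_horner_split (es : seq R) (x h : R) :
  sqn (\prod_(e <- es) ('X - (e%:C)%:P)).[x +i* h] =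
  \prod_(e <- es) ((x - e) ^+ 2 + h ^+ 2).
Proof.
rewrite horner_prod sqn_prod; apply: eq_bigr => e _.
by rewrite hornerXsubC /sqn /=; ring.
Qed.

Lemma horner_split_real (es : seq R) (x : R) :
  (\prod_(e <- es) ('X - (e%:C)%:P)).[x%:C] = (\prod_(e <- es) (x - e))%:C.
Proof.
by rewrite horner_prod rmorph_prod; apply: eq_bigr => e _; rewrite hornerXsubC rmorphB.
Qed.

Lemma trace_split (q : nat) (tau : R[i]) : (0 < q)%N -> sqn tau = 1 ->
  exists2 es : seq R, size es = q &
    trace_poly V q - (tau + tau^-1)%:P = \prod_(e <- es) ('X - (e%:C)%:P).
Proof.
move=> q0 t1; have [sD mD] := trace_monic V (tau + tau^-1) q0.
have [|es ses Des] := real_split mD.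
  move=> z /eqP; rewrite hornerD hornerN hornerC subr_eq0 => /eqP.
  exact: (trace_real_root q0 t1).
by exists es => //; apply: succn_inj; rewrite -ses.
Qed.

(** The multipliers ['i], 1 and -1 correspond to the trace values 0, 2 and -2; the zeros for the
    last two together are those of [D ^+ 2 - 4]. *)
Lemma trace_zeros (q : nat) : (0 < q)%N ->
  exists es fs : seq R, [/\ size es = q,
    trace_poly V q = \prod_(e <- es) ('X - (e%:C)%:P) &
    trace_poly V q ^+ 2 - 4%:P = \prod_(f <- fs) ('X - (f%:C)%:P)].
Proof.
move=> q0.
have [|es ses Des] := @trace_split q 'i q0; first by rewrite /sqn /=; ring.
have [|f1 _ Df1] := @trace_split q 1 q0; first by rewrite sqn_real expr1n.
have [|f2 _ Df2] := @trace_split q (-1) q0; first by rewrite sqnN sqn_real expr1n.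
exists es, (f1 ++ f2); split => //.
  rewrite -Des.
  have -> : 'i + 'i^-1 = 0 :> R[i].
    by apply/eqP; rewrite eq_complex /= !(expr0n, expr1n) /=; apply/andP; split; apply/eqP; field.
  by rewrite subr0.
rewrite big_cat /= -Df1 -Df2 invrN1 invr1.
have -> : (4%:P : {poly R[i]}) = (1 + 1)%:P ^+ 2 by rewrite -polyC_exp; congr polyC; ring.
have -> : ((- 1 - 1)%:P : {poly R[i]}) = - (1 + 1)%:P by rewrite -polyCN; congr polyC; ring.
by ring.
Qed.

(** The corner entries act as the boundary values [u 0 = 'i * u q] and [u q.+1 = - 'i * u 1]. Row
    vectors are used because [eigenvalue] refers to them. *)
Lemma periodic_col (q : nat) (u : nat -> R[i]) (j : 'I_q) :
  ((\row_(i < q) u i.+1) *m periodic_mx V q (pi / 2)) 0 j =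
    (V j.+1)%:C * u j.+1 + (if (j == 0 :> nat) then 'i * u q else u j)
    + (if j.+1 == q then - 'i * u 1%N else u j.+2).
Proof.
have ij_sum := @sum_pick_ord R[i] q.
have jq := ltn_ord j; rewrite mxE.
transitivity (\sum_(i < q) (((V i.+1)%:C * u i.+1) *+ (i == j :> nat)
  + ((u i.+1 *+ (0 < j)%N) *+ (i == j.-1 :> nat) + u i.+1 *+ (i == j.+1 :> nat))
  + (- 'i * u 1%N *+ (j.+1 == q)) *+ (i == 0 :> nat)
  + ('i * u i.+1 *+ (j == 0 :> nat)) *+ (i == q.-1 :> nat))).
  apply: eq_bigr => i _; have iq := ltn_ord i; rewrite !mxE cos_pihalf sin_pihalf.
  have -> : (0 -i* 1) = - 'i :> R[i].
    by apply/eqP; rewrite eq_complex /= oppr0 !eqxx.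
  have -> : 0 +i* 1 = 'i :> R[i] by [].
  rewrite !mulrDr -!mulrnA !mulnb; congr (_ + _ + _ + _).
  - by rewrite mulrnAr mulrC.
  - rewrite -mulrnDr mulr_natr; congr (_ *+ _).
    by move: (nat_of_ord i) (nat_of_ord j) => a b; lia.
  - rewrite [in RHS]andbC mulrnAr mulrC; have [->|] := eqVneq (nat_of_ord i) 0%N; by [].
  - rewrite mulrnAr mulrC; congr (_ *+ _); congr nat_of_bool; lia.
rewrite !big_split /= (ij_sum (fun i => (V i.+1)%:C * u i.+1)).
rewrite (ij_sum (fun i => u i.+1 *+ (0 < j)%N)) (ij_sum (fun i => u i.+1)).
rewrite (ij_sum (fun=> - 'i * u 1%N *+ (j.+1 == q)))
  (ij_sum (fun i => 'i * u i.+1 *+ (j == 0 :> nat))).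
rewrite jq (leq_ltn_trans (leq_pred _) jq) (leq_ltn_trans (leq0n _) jq).
have q0 : (0 < q)%N by exact: leq_ltn_trans jq.
rewrite !(prednK q0) leqnn -!addrA; congr (_ + _).
case: (posnP j) => [->|j0].
  rewrite mulr0n !mulr1n add0r.
  have [<-|q1] := eqVneq 1%N q; first by rewrite ltnn mulr1n; ring.
  have -> : (1 < q)%N by lia.
  by rewrite mulr0n; ring.
rewrite prednK// mulr1n mulr0n.
have [jq1|q1] := eqVneq j.+1 q.
  have -> : (j.+1 < q)%N = false by lia.
  by rewrite mulr1n; ring.
have -> : (j.+1 < q)%N by lia.
by rewrite mulr0n; ring.
Qed.

(** Eigenvectors are the quasi-periodic solutions with multiplier [tau = 'i], and
    ['i + 'i^-1 = 0]. *)
Lemma frakE_trace (q : nat) (e : R) : (0 < q)%N ->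
  frakE V q e <-> (trace_poly V q).[e%:C] = 0.
Proof.
move=> q0.
have i0 : 'i != 0 :> R[i] by rewrite eq_complex /= oner_eq0 andbF.
have ii : 'i * 'i = -1 :> R[i] by rewrite -expr2 sqr_i.
have iV : 'i + 'i^-1 = 0 :> R[i].
  by apply: (mulfI i0); rewrite mulrDr ii divff// mulr0 addNr.
split=> [/eigenvalueP[v vA v0]|De].
  pose m := q.-1; have mq : m.+1 = q by rewrite prednK.
  (* [w] extends the eigenvector by zero; [u] shifts it by one site and adds the values at 0 and
     [q.+1] dictated by the corners. *)
  pose w n : R[i] := if insub n is Some i then v 0 i else 0.
  have wv (i : 'I_q) : w i = v 0 i.
    by rewrite /w insubT//= => h; congr (v 0 _); apply: val_inj.
  pose u n : R[i] := if n is n'.+1 then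
     (if n' == q then - 'i * w 0%N else w n') else 'i * w q.-1.
  have uq : u q = w q.-1 by rewrite -mq /= -[q in _ == q]mq; case: eqVneq => //; lia.
  have u1 : u 1%N = w 0%N by rewrite /u; case: eqVneq => // q1; move: q0; rewrite -q1.
  have vE : v = \row_(i < q) u i.+1.
    by apply/rowP => i; rewrite mxE /u; case: eqVneq => [iq|_]; [have := ltn_ord i; lia|rewrite wv].
  have su : solves V e%:C u q.
    move=> n nq; have := congr1 (fun M : 'rV_q => M 0 (Ordinal nq)) vA.
    rewrite {1}vE periodic_col mxE -wv [nat_of_ord _]/=.
    have -> : w n = u n.+1 by rewrite /u; case: eqVneq => // nq'; move: nq; rewrite nq' ltnn.
    move=> <-; rewrite addrC [u n.+2 + _]addrC addrA; congr (_ + _ + _).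
      by case: (eqVneq n 0%N) => [->|] //; rewrite uq.
    by rewrite [u n.+2]/u; case: (eqVneq n.+1 q) => // _; rewrite -u1.
  have Q0 : u 0%N = 'i * u q by rewrite uq.
  have Q1 : u 1%N = 'i * u q.+1.
    by rewrite [u q.+1]/u eqxx -u1 mulrA mulrN ii opprK mul1r.
  have unz : (u 0%N, u 1%N) != (0, 0).
    apply: contra v0 => e0; have [u00 u10] : u 0%N = 0 /\ u 1%N = 0 by case/eqP: e0.
    apply/eqP/rowP => i; rewrite vE !mxE.
    by rewrite (solves_fundamental su) ?ltnS ?(ltnW (ltn_ord i))// u00 u10 !mul0r addr0.
  have wr := wronskian_fundamental V e%:C q.
  rewrite (solves_fundamental su (leqnSn q)) in Q0.
  rewrite (solves_fundamental su (leqnn q.+1)) in Q1.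
  rewrite /trace_poly hornerD.
  move: Q0 Q1 wr unz; move: (u 0%N) (u 1%N) => a b.
  set p' := (dirichlet V q.+1).[_]; set p := (dirichlet V q).[_].
  set r' := (neumann V q.+1).[_]; set r := (neumann V q).[_] => Q0 Q1 wr abnz.
  (* Cramer's rule: the boundary equations are combined with cofactors, and the determinant reduces
     to [- 'i * (p' + r)] because the Wronskian is 1 and ['i * 'i = -1]. *)
  have Da : 'i * (p' + r) * a = 0.
    have : (1 - 'i * p') * (a - 'i * (b * p + a * r)) + 'i * p * (b - 'i * (b * p' + a * r')) = 0.
      by rewrite -Q0 -Q1 !subrr !mulr0 addr0.
    move=> h; apply/eqP; rewrite -oppr_eq0 -h; apply/eqP.
    transitivity ((1 - 'i * (p' + r) + 'i * 'i * (p' * r - p * r')) * a); last by ring.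
    by rewrite ii wr; ring.
  have Db : 'i * (p' + r) * b = 0.
    have : (1 - 'i * r) * (b - 'i * (b * p' + a * r')) + 'i * r' * (a - 'i * (b * p + a * r)) = 0.
      by rewrite -Q0 -Q1 !subrr !mulr0 addr0.
    move=> h; apply/eqP; rewrite -oppr_eq0 -h; apply/eqP.
    transitivity ((1 - 'i * (p' + r) + 'i * 'i * (p' * r - p * r')) * b); last by ring.
    by rewrite ii wr; ring.
  apply/eqP; apply: contraNT abnz => Dnz.
  move/eqP: Da; move/eqP: Db; rewrite !mulf_eq0 (negPf i0) (negPf Dnz)/=.
  by move=> /eqP -> /eqP ->.
pose tau : R[i] := 'i.
have Dtau : (trace_poly V q).[e%:C] = tau + tau^-1 by rewrite De iV.
have [|u [su u0 u1 unz]] := solves_quasiperiodic q0 i0 Dtau.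
  left; rewrite sqr_i eq_complex /=; apply/negP => /andP[/eqP]; lra.
have uq1 : u q.+1 = - 'i * u 1%N by rewrite u1 mulrA mulNr ii opprK mul1r.
apply/eigenvalueP; exists (\row_(i < q) u i.+1).
  apply/rowP => j; rewrite periodic_col mxE mxE -(su j (ltn_ord j)).
  rewrite [RHS]addrC [u j.+2 + _]addrC [RHS]addrA; congr (_ + _ + _).
    by case: (eqVneq (nat_of_ord j) 0%N) => [->|] //; rewrite u0.
  by case: (eqVneq j.+1 q) => [jq|] //; rewrite -uq1; congr (u _.+1).
apply/eqP => /rowP vz; have {}vz n : (n < q)%N -> u n.+1 = 0.
  by move=> nq; have := vz (Ordinal nq); rewrite !mxE.
by move: unz; rewrite u0 vz// -[q in u q](prednK q0) vz ?prednK// mulr0 eqxx.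
Qed.
End Zeros.

Lemma clustered_trace_ge (R : realType) (V : nat -> R) (q n : nat) (eps xi h x : R)
    (S : {fset interval R}) :
  (0 < q)%N -> clustered V q eps xi S -> n%:R < q%:R `^ xi -> 0 < h -> eps <= h ->
  4 * (5 / 4) ^+ n <= (sqn (trace_poly V q).[x +i* h] + 4) ^+ 2.
Proof.
move=> q0 [_ Sclosed _ Scover Snum] nq h0 eh.
have [es [fs [ses Des Dfs]]] := trace_zeros V q0.
have esP e : e \in es <-> frakE V q e.
  rewrite frakE_trace// Des horner_split_real -horner_prod_XsubC.
  rewrite -root_prod_XsubC rootE.
  split=> [/eqP -> //|/eqP]; by rewrite eq_complex /= eqxx andbT.
rewrite Des sqn_horner_split.
apply: (@trace_height_ge _ es fs n eps) => //.
- move=> y; apply: complexI.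
  by rewrite -[RHS]horner_split_real -Dfs hornerD hornerN horner_exp hornerC
    Des horner_split_real rmorphB rmorphXn rmorph_nat.
- move=> y k; rewrite -!sqn_horner_split -Dfs -Des hornerD hornerN horner_exp hornerC.
  exact: sqn_sqrB4.
- by apply/eqP => es0; move: q0; rewrite -ses es0.
move=> e /esP/Scover[I IS eI].
have [[a [b [ab Iab]]] lenI] := Sclosed _ IS.
have fin : finite_set (frakE V q `&` [set` I]).
  apply: (@sub_finite_set _ _ [set` es]); last exact: finite_seq.
  by move=> z [/esP zes _].
exists (enum_fset (fset_set (frakE V q `&` [set` I]))); split.
- exact: fset_uniq.
- by have := lt_le_trans nq (Snum _ IS); rewrite ltr_nat.
- move=> z; rewrite [_ \in _](in_fset_set fin) inE => -[/esP].
  by [].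
move=> z; rewrite [_ \in _](in_fset_set fin) inE => -[_ /=].
move: eI lenI; rewrite Iab /len lebesgue_measure_itv /= !in_itv /= lte_fin.
(* The interval has measure [b - a] if [a < b]; otherwise it is a single point and [z = e]. *)
case: ltP => [ab'|ba] eI; rewrite ?EFinN -?EFinB ?lee_fin => le zI.
  by rewrite ler_norml; lra.
by rewrite (_ : z - e = 0) ?normr0//; lra.
Qed.

(** * Spectral representation of finite truncations *)

Section Truncation.
Variable R : realType.
Variable V : nat -> R.

Definition jacobi_mx (L : nat) : 'M[R[i]]_L :=
  \matrix_(i < L, j < L) ((V i.+1)%:C *+ (i == j)
     + ((j == i.+1 :> nat) || (i == j.+1 :> nat))%:R).

Lemma jacobi_hermitian L : jacobi_mx L \is hermsymmx.
Proof.
apply/is_hermitianmxP; apply/matrixP => i j; rewrite !mxE /= expr0 mul1r.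
rewrite rmorphD rmorphMn rmorph_nat orbC eq_sym; congr (_ + _).
case: (eqVneq j i) => [->|_]; last by rewrite !mulr0n.
by rewrite !mulr1n; exact/esym/conjc_real.
Qed.

(** Coordinates are renumbered from 1; the zeros at 0 and beyond [L] express the Dirichlet
    conditions at both ends. *)
Definition zero_ext L (v : 'rV[R[i]]_L) (n : nat) : R[i] :=
  if n is m.+1 then (if insub m is Some i then v 0 i else 0) else 0.

Arguments zero_ext : simpl never.

Lemma zero_ext_ord L (v : 'rV[R[i]]_L) (i : 'I_L) : zero_ext v i.+1 = v 0 i.
Proof. by rewrite /zero_ext insubT//= => h; congr (v 0 _); apply: val_inj. Qed.

Lemma zero_ext_out L (v : 'rV[R[i]]_L) (n : nat) : (L < n)%N -> zero_ext v n = 0.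
Proof. by case: n => // n; rewrite ltnS => Ln; rewrite /zero_ext insubF// ltnNge Ln. Qed.

Lemma jacobi_col L (v : 'rV[R[i]]_L) (i : 'I_L) :
  (v *m jacobi_mx L) 0 i =
    (V i.+1)%:C * zero_ext v i.+1 + (zero_ext v i + zero_ext v i.+2).
Proof.
rewrite mxE; have iL := ltn_ord i.
transitivity (\sum_(k < L) (((V k.+1)%:C * zero_ext v k.+1) *+ (k == i :> nat)
  + ((zero_ext v k.+1 *+ (0 < i)%N) *+ (k == i.-1 :> nat)
    + zero_ext v k.+1 *+ (k == i.+1 :> nat)))).
  apply: eq_bigr => k _; rewrite !mxE -zero_ext_ord.
  rewrite !mulrDr -!mulrnA !mulnb; congr (_ + _); first by rewrite mulrnAr mulrC.
  rewrite -mulrnDr mulr_natr; congr (_ *+ _).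
  by move: (nat_of_ord k) (nat_of_ord i) => a b; lia.
rewrite !big_split /= (sum_pick_ord _ (fun k => (V k.+1)%:C * zero_ext v k.+1)).
rewrite (sum_pick_ord _ (fun k => zero_ext v k.+1 *+ (0 < i)%N))
  (sum_pick_ord _ (fun k => zero_ext v k.+1)).
rewrite iL (leq_ltn_trans (leq_pred _) iL); congr (_ + (_ + _)).
  by case: (posnP i) => [->|i0]; rewrite ?mulr0n// prednK// mulr1n.
by case: ltnP => // iL'; rewrite zero_ext_out.
Qed.


Lemma zero_ext_solves L (v : 'rV[R[i]]_L) (z : R[i]) :
  v *m jacobi_mx L = z *: v -> solves V z (zero_ext v) L.
Proof.
move=> vA m mL; have := congr1 (fun M : 'rV_L => M 0 (Ordinal mL)) vA.
rewrite jacobi_col mxE -zero_ext_ord /= => <-.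
by rewrite addrC [_ + zero_ext v m]addrC.
Qed.

(** The eigenvalue equation is read at a coordinate of maximal modulus. *)
Lemma jacobi_eigen_bound (M : R) L (v : 'rV[R[i]]_L) (l : R) :
  (forall n, (0 < n)%N -> `|V n| <= M) ->
  v *m jacobi_mx L = (l%:C) *: v -> v != 0 -> `|l| <= M + 2.
Proof.
move=> VM /zero_ext_solves vA v0.
have [i0 vi0] : exists i, v 0 i != 0.
  apply: contrapT => h; move/eqP: v0; apply; apply/rowP => i; rewrite mxE.
  by apply/eqP; apply: contrapT => /negP vi; apply: h; exists i.
pose f n := Normc.normc (zero_ext v n).
have [i _ fmax] := @arg_maxP _ _ _ i0 xpredT (fun i : 'I_L => f i.+1) isT.
have f0 n : 0 <= f n by rewrite /f; case: (zero_ext v n) => a b /=; exact: sqrtr_ge0.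
have fle n : f n <= f i.+1.
  case: n => [|n]; first by rewrite {1}/f /= expr0n /= addr0 sqrtr0.
  have [nL|Ln] := ltnP n L; first exact: (fmax (Ordinal nL)).
  by rewrite {1}/f zero_ext_out// /= expr0n /= addr0 sqrtr0.
have fi : 0 < f i.+1.
  apply: lt_le_trans (fmax i0 isT); rewrite lt_neqAle f0 andbT eq_sym.
  by apply: contra vi0 => /eqP/Normc.eq0_normc; rewrite zero_ext_ord => ->.
have := vA i (ltn_ord i) => /(congr1 (@Normc.normc R)).
rewrite [RHS]Normc.normcM -/(f _).
have nr (x : R) : Normc.normc x%:C = `|x| by rewrite /= expr0n addr0 sqrtr_sqr.
rewrite nr => e; rewrite -(ler_pM2r fi) -e.
apply: le_trans (le_normcD _ _) _; rewrite Normc.normcM nr -/(f _).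
have h1 := le_normcD (zero_ext v i.+2) (zero_ext v i).
have h2 := fle i; have h3 := fle i.+2; have h4 : `|V i.+1| * f i.+1 <= M * f i.+1.
  by rewrite ler_wpM2r// VM.
apply: le_trans (lerD h1 h4) _; rewrite -/(f _) -/(f _); lra.
Qed.

Lemma sqn_dotmx n (v : 'rV[R[i]]_n) : (\sum_j sqn (v 0 j))%:C = (v *m (v ^t* )%sesqui) 0 0.
Proof.
by rewrite mxE rmorph_sum; apply: eq_bigr => j _; rewrite !mxE -normCK; exact: sqn_norm.
Qed.

(* [c j n] is the product of the coordinates [1] and [n] of the [j]-th
   eigenvector of an orthonormal eigenbasis of the truncation of H to
   [1, ..., L]. *)
Definition spectral_rep (K : R) (L : nat)
    (lam : 'I_L -> R) (c : 'I_L -> nat -> R[i]) : Prop :=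
  [/\ forall j, `|lam j| <= K,
      forall j, [/\ solves V (lam j)%:C (c j) L, c j 0%N = 0 & c j L.+1 = 0],
      forall n, (0 < n <= L.+1)%N -> \sum_j c j n = (n == 1%N)%:R &
      forall (a : 'I_L -> R[i]) (B : R), (forall j, sqn (a j) <= B) ->
        \sum_(0 <= n < L) sqn (\sum_j a j * c j n.+1) <= B].

(** The rows of a unitary [P] diagonalizing the Hermitian truncation are eigenvectors; [u 0 j] is
    the conjugate of the first coordinate of the [j]-th one. *)
Lemma spectral_rep_exists (M : R) (L : nat) : (0 < L)%N ->
  (forall n, (0 < n)%N -> `|V n| <= M) ->
  exists (lam : 'I_L -> R) (c : 'I_L -> nat -> R[i]), spectral_rep (M + 2) lam c.
Proof.
move=> L0 VM; pose A := jacobi_mx L; pose P := spectralmx A.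
have hA : A \is hermsymmx := jacobi_hermitian L.
have /orthomx_spectralP AE := hermitian_normalmx hA.
have Pu : P \is unitarymx := spectral_unitarymx A.
have Pi : P \in unitmx := unitarymx_unit Pu.
have PiE := invmx_unitary Pu.
have PtP : (P ^t* )%sesqui *m P = 1%:M by rewrite -PiE mulVmx.
have PPt : P *m (P ^t* )%sesqui = 1%:M by rewrite -PiE mulmxV.
pose d := spectral_diag A; pose lam j : R := complex.Re (d 0 j).
have dlam j : d 0 j = (lam j)%:C.
  have /mxOverP/(_ 0 j) := hermitian_spectral_diag_real hA.
  by move=> /RRe_real.
have PA : P *m A = diag_mx d *m P by rewrite [in LHS]AE !mulmxA mulmxV// mul1mx.
have rowPA j : row j P *m A = (lam j)%:C *: row j P.
  rewrite -row_mul PA mul_diag_mx; apply/rowP => k.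
  by rewrite !mxE dlam.
have rowN0 j : row j P != 0.
  apply/eqP => r0; have := congr1 (row j) PPt; rewrite row_mul r0 mul0mx => /rowP/(_ j).
  by rewrite !mxE eqxx => /eqP; rewrite eq_sym oner_eq0.
pose u : 'rV[R[i]]_L := row (Ordinal L0) (P ^t* )%sesqui.
have uu : \sum_j sqn (u 0 j) = 1.
  apply: complexI; transitivity (((P ^t* )%sesqui *m P) (Ordinal L0) (Ordinal L0)).
    rewrite [RHS]mxE rmorph_sum; apply: eq_bigr => k _; rewrite !mxE.
    by rewrite -[X in _ = _ * X]conjCK -normCK; exact: sqn_norm.
  by rewrite PtP mxE eqxx.
exists lam, (fun j n => u 0 j * zero_ext (row j P) n); split.
- by move=> j; apply: (jacobi_eigen_bound VM (rowPA j)).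
- move=> j; split; last by rewrite zero_ext_out// mulr0.
    have := solves_comb (u 0 j) 0 (zero_ext_solves (rowPA j)) (zero_ext_solves (rowPA j)).
    by move=> h n nL; have := h n nL; rewrite !mul0r !addr0.
  by rewrite mulr0.
- move=> [|n]// /andP[_]; rewrite ltnS leq_eqVlt => /predU1P[->|nL].
    rewrite big1 => [|j _]; last by rewrite zero_ext_out// mulr0.
    by have -> : (L.+1 == 1%N) = false by rewrite eqSS gtn_eqF.
  transitivity ((u *m P) 0 (Ordinal nL)).
    rewrite mxE; apply: eq_bigr => j _; congr (_ * _).
    by rewrite (zero_ext_ord _ (Ordinal nL)) mxE.
  by rewrite /u -row_mul PtP !mxE -(inj_eq val_inj) /= eq_sym.
(* The sums are the coordinates of [w *m P]; the unitary [P] preserves the norm of [w], whose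
   squared entries are at most [B] times weights of total 1. *)
move=> a B aB; pose w : 'rV[R[i]]_L := \row_j (a j * u 0 j).
have wP n : (n < L)%N -> \sum_j a j * (u 0 j * zero_ext (row j P) n.+1) = zero_ext (w *m P) n.+1.
  move=> nL; rewrite (zero_ext_ord _ (Ordinal nL)) mxE; apply: eq_bigr => j _.
  have -> : w 0 j = a j * u 0 j by rewrite mxE.
  rewrite (zero_ext_ord _ (Ordinal nL)) -mulrA; congr (_ * (_ * _)).
  by rewrite mxE.
rewrite big_mkord; under eq_bigr => n _ do rewrite wP// zero_ext_ord.
have -> : \sum_(i < L) sqn ((w *m P) 0 i) = \sum_j sqn (w 0 j).
  apply: complexI; rewrite !sqn_dotmx.
  have -> : ((w *m P) ^t* )%sesqui = (P ^t* )%sesqui *m (w ^t* )%sesqui.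
    by rewrite trmx_mul map_mxM.
  by rewrite mulmxA -(mulmxA w) PPt mulmx1.
rewrite -[B]mulr1 -uu mulr_sumr; apply: ler_sum => j _.
by rewrite mxE sqnM ler_wpM2r ?sqn_ge0.
Qed.

Variables (L : nat) (lam : 'I_L -> R) (c : 'I_L -> nat -> R[i]).
Hypothesis c_eigen :
  forall j, [/\ solves V (lam j)%:C (c j) L, c j 0%N = 0 & c j L.+1 = 0].
Hypothesis c_total :
  forall n, (0 < n <= L.+1)%N -> \sum_j c j n = (n == 1%N)%:R.

(** Finite propagation speed: [k] steps from site [n] reach at most [n + k], so a truncation with
    [n + k <= L.+1] gives the exact value for the half line. *)
Lemma moment_rep k n : (0 < n)%N -> (n + k <= L.+1)%N ->
  \sum_j (lam j)%:C ^+ k * c j n = iter k (schrodinger V) (delta R 1) n.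
Proof.
elim: k n => [|k IH] n n0 nL.
  by under eq_bigr do rewrite expr0 mul1r; rewrite c_total ?n0 ?(leq_trans (leq_addr _ _) nL).
case: n n0 nL => // n _ nL.
have nltL : (n < L)%N by lia.
transitivity (\sum_j ((lam j)%:C ^+ k * c j n.+2 + (lam j)%:C ^+ k * c j n
   + (V n.+1)%:C * ((lam j)%:C ^+ k * c j n.+1))).
  apply: eq_bigr => j _; have [/(_ n nltL) e _ _] := c_eigen j.
  by rewrite exprSr -mulrA -e; ring.
rewrite !big_split /= -mulr_sumr (IH n.+2)//; last by lia.
rewrite (IH n.+1)//; last by lia.
case: n nL nltL => [|n] nL nltL.
  by rewrite big1 ?addr0// => j _; have [_ -> _] := c_eigen j; rewrite mulr0.
by rewrite IH//; lia.
Qed.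

Lemma resolvent_rep (z : R[i]) q : 0 < complex.Im z -> (0 < q < L)%N ->
  2 * complex.Im z ^+ 4 * sqn (trace_poly V q).[z] *
    \sum_(q.+1 <= n < L) sqn (\sum_j ((lam j)%:C - z)^-1 * c j n.+1)
  <= 1 + complex.Im z ^+ 2.
Proof.
move=> h0 /andP[q0 qL].
(* The value -1 at 0 turns the source at site 1 of the resolvent equation into a boundary value, as
   [resolvent_trace] requires. *)
pose g n : R[i] := if n is 0%N then -1 else \sum_j ((lam j)%:C - z)^-1 * c j n.
have lz j : (lam j)%:C - z != 0.
  apply/eqP => /(congr1 (@complex.Im R)) /=; case: (z) h0 => a b /= b0.
  by rewrite add0r => /eqP; rewrite oppr_eq0 gt_eqF.
apply: (@resolvent_trace R V z g q L) => //; last first.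
  by rewrite /g big1// => j _; have [_ _ ->] := c_eigen j; rewrite mulr0.
move=> m mL.
have key : \sum_j ((lam j)%:C - z)^-1 * (c j m.+2 + c j m + (V m.+1)%:C * c j m.+1)
    = (m == 0%N)%:R + z * g m.+1.
  have mL1 : (0 < m.+1 <= L.+1)%N by rewrite !ltnS (ltnW mL).
  have gE : g m.+1 = \sum_j ((lam j)%:C - z)^-1 * c j m.+1 by [].
  rewrite -[(m == 0%N)]/(m.+1 == 1%N) -(c_total mL1) gE mulr_sumr -big_split.
  apply: eq_bigr => j _ /=; have [/(_ m mL) -> _ _] := c_eigen j.
  have -> : (lam j)%:C * c j m.+1 = ((lam j)%:C - z) * c j m.+1 + z * c j m.+1 by ring.
  by rewrite mulrDr mulKf//; congr (_ + _); rewrite mulrCA.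
have -> : g m.+2 + g m + (V m.+1)%:C * g m.+1 =
  \sum_j ((lam j)%:C - z)^-1 * (c j m.+2 + c j m + (V m.+1)%:C * c j m.+1) - (m == 0%N)%:R.
  under eq_bigr do rewrite !mulrDr [_ * (_ * _)]mulrCA; rewrite !big_split /= -mulr_sumr.
  case: m {mL key} => [|m] /=; last by rewrite subr0.
  rewrite [X in _ + X + _ - _]big1 ?addr0; first by rewrite addrAC.
  by move=> j _; have [_ -> _] := c_eigen j; rewrite mulr0.
by rewrite key addrAC subrr add0r.
Qed.

End Truncation.

(** * Roots of unity and partial fractions *)

Lemma prim_root_exists (F : closedFieldType) (n : nat) :
  (n%:R : F) != 0 -> exists z : F, n.-primitive_root z.
Proof.
move=> nF; have n_gt0 : (0 < n)%N by case: n nF; rewrite ?eqxx.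
have [r Dp] := closed_field_poly_normal ('X^n - 1 : {poly F}).
rewrite (monicP _) ?monicXnsubC // scale1r in Dp.
have rn1 : all n.-unity_root r by apply/allP => z; rewrite -root_prod_XsubC -Dp.
have sz_r : (n < (size r).+1)%N by rewrite -(size_prod_XsubC r id) -Dp size_XnsubC.
have [|z _ zn] := hasP (has_prim_root n_gt0 rn1 _ sz_r); last by exists z.
by rewrite -separable_prod_XsubC -Dp separable_Xn_sub_1.
Qed.

(** Dividing [X ^+ k - r ^+ k] by each [X - r * w ^+ s] gives a geometric sum; summing over [s]
    cancels every power of [w] except [w ^+ k]. *)
Lemma partial_fractions_unity (F : fieldType) (k : nat) (w X r : F) :
  k.-primitive_root w -> X ^+ k != r ^+ k ->
  \sum_(s < k) w ^+ s / (X - r * w ^+ s) = k%:R * r ^+ k.-1 / (X ^+ k - r ^+ k).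
Proof.
move=> wk Xr; have k0 := prim_order_gt0 wk.
have wsk (s : nat) : (w ^+ s) ^+ k = 1 by rewrite exprAC (prim_expr_order wk) expr1n.
have D0 : X ^+ k - r ^+ k != 0 by rewrite subr_eq0.
have Xs (s : nat) : X - r * w ^+ s != 0.
  by apply: contra Xr; rewrite subr_eq0 => /eqP ->; rewrite exprMn wsk mulr1.
apply: (mulIf D0); rewrite mulfVK// mulr_suml.
transitivity (\sum_(s < k) \sum_(j < k) X ^+ (k.-1 - j) * r ^+ j * (w ^+ j.+1) ^+ s).
  apply: eq_bigr => s _.
  have -> : X ^+ k - r ^+ k = (X - r * w ^+ s) * \sum_(j < k) X ^+ (k.-1 - j) * (r * w ^+ s) ^+ j.
    by rewrite -subrXX exprMn wsk mulr1.
  rewrite mulrA divfK// mulr_sumr; apply: eq_bigr => j _.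
  by rewrite exprMn [(w ^+ j.+1) ^+ s]exprAC exprS -!mulrA mulrCA; congr (_ * _); exact: mulrCA.
rewrite exchange_big /=; under eq_bigr do rewrite -mulr_sumr.
rewrite -(prednK k0) big_ord_recr /= subnn expr0 mul1r.
rewrite big1 ?add0r => [|j _].
  rewrite prednK// (prim_expr_order wk).
  by under eq_bigr do rewrite expr1n; rewrite sumr_const card_ord mulrC.
rewrite [X in _ * X](_ : _ = 0) ?mulr0//.
have w1 : w ^+ j.+1 - 1 != 0.
  rewrite subr_eq0 -(prim_order_dvd wk) gtnNdvd//.
  by rewrite -[X in (_ < X)%N](prednK k0) ltnS.
apply: (mulfI w1); rewrite prednK// -subrX1 mulr0.
by rewrite exprAC (prim_expr_order wk) expr1n subrr.
Qed.

(** * The function [e^{-ix}] and its approximation by resolvent powers *)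

Section Cis.
Variable R : realType.
Notation normc := (@Normc.normc R).

Lemma normc_ge0 (z : R[i]) : 0 <= normc z.
Proof. by case: z => a b /=; exact: sqrtr_ge0. Qed.

Lemma normc_real (x : R) : normc x%:C = `|x|.
Proof. by rewrite /= expr0n addr0 sqrtr_sqr. Qed.

Lemma normcX (z : R[i]) n : normc (z ^+ n) = normc z ^+ n.
Proof.
elim: n => [|n IH]; last by rewrite !exprS Normc.normcM IH.
by rewrite !expr0 Normc.normc1.
Qed.

Lemma normc_le (z : R[i]) (B : R) : 0 <= B -> (normc z <= B) = (sqn z <= B ^+ 2).
Proof. by move=> B0; rewrite -normc_sqr ler_pXn2r// nnegrE ?normc_ge0. Qed.

Lemma ler_normc_subX (a b : R[i]) (k : nat) : normc a <= 1 -> normc b <= 1 ->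
  normc (a ^+ k - b ^+ k) <= k%:R * normc (a - b).
Proof.
move=> a1 b1; elim: k => [|k IH]; first by rewrite !expr0 subrr Normc.normc0 mul0r.
have -> : a ^+ k.+1 - b ^+ k.+1 = a * (a ^+ k - b ^+ k) + (a - b) * b ^+ k.
  by rewrite !exprS; ring.
apply: le_trans (le_normcD _ _) _; rewrite !Normc.normcM -natr1 mulrDl mul1r.
apply: lerD; first by apply: le_trans IH; rewrite ler_piMl// normc_ge0.
by rewrite ler_piMr ?normc_ge0// normcX exprn_ile1 ?normc_ge0.
Qed.

(** This is [e^{-ix}], with the sign of [e^{-itH}]. *)
Definition cisN (x : R) : R[i] := cos x -i* sin x.

Lemma cisND x y : cisN (x + y) = cisN x * cisN y.
Proof. by rewrite /cisN cosD sinD;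
  apply/eqP; rewrite eq_complex /=; apply/andP; split; apply/eqP; ring. Qed.

Lemma cisN_expn x n : cisN (n%:R * x) = cisN x ^+ n.
Proof.
elim: n => [|n IH]; last by rewrite -natr1 mulrDl mul1r cisND IH exprSr.
by rewrite mul0r expr0 /cisN cos0 sin0 oppr0.
Qed.

Lemma sqn_cisN x : sqn (cisN x) = 1.
Proof. by rewrite /sqn /= sqrrN cos2Dsin2. Qed.

Lemma sin_mean_value (u : R) : 0 <= u -> exists2 c, 0 <= c <= u & sin u = cos c * u.
Proof.
move=> u0; have [|c] := @MVT_segment R sin cos 0 u u0 (fun x _ => is_derive_sin x).
  by apply: continuous_subspaceT; exact: continuous_sin.
by rewrite in_itv /= sin0 !subr0 => c0u e; exists c.
Qed.

Lemma cos_ge_quadratic (u : R) : 0 <= u -> 1 - cos u <= u ^+ 2 / 2.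
Proof.
move=> u0; have u20 : 0 <= u / 2 by rewrite divr_ge0.
have -> : cos u = 1 - sin (u / 2) ^+ 2 *+ 2.
  have cs := cos2Dsin2 (u / 2).
  rewrite [in LHS](_ : u = (u / 2) *+ 2); last by rewrite -mulr_natr divfK ?pnatr_eq0.
  rewrite cos_mulr2n; lra.
have [c _ e] := sin_mean_value u20; rewrite e.
have c1 : cos c ^+ 2 <= 1 by have := cos2Dsin2 c; have := sqr_ge0 (sin c); lra.
have : (u / 2) ^+ 2 * cos c ^+ 2 <= (u / 2) ^+ 2 * 1 by rewrite ler_wpM2l// sqr_ge0.
rewrite exprMn; nra.
Qed.

Lemma sin_ge_cubic (y : R) : 0 <= y -> y - sin y <= y ^+ 3 / 2.
Proof.
move=> y0; have [c /andP[c0 cy] ->] := sin_mean_value y0.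
have := cos_ge_quadratic c0.
have : c ^+ 2 <= y ^+ 2 by rewrite ler_pXn2r ?nnegrE.
move=> h1 h2; have : y * (1 - cos c) <= y * (y ^+ 2 / 2) by rewrite ler_wpM2l//; lra.
have -> : y ^+ 3 = y * y ^+ 2 by ring.
lra.
Qed.

(** The left side is [2 (1 - cos y) + 2 y (y - sin y) - y^2], where the first term is at most [y^2]
    and the second at most [y^4]. *)
Lemma sqn_cis_resolvent (y : R) : sqn ((1 +i* y) * cisN y - 1) <= y ^+ 4.
Proof.
have -> : sqn ((1 +i* y) * cisN y - 1) = 2 + y ^+ 2 - 2 * cos y - 2 * (y * sin y).
  transitivity ((cos y ^+ 2 + sin y ^+ 2) * (1 + y ^+ 2) + 1 - 2 * cos y - 2 * (y * sin y)).
    by rewrite /sqn /=; ring.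
  by rewrite cos2Dsin2; ring.
wlog y0 : y / 0 <= y => [H|].
  have [/H//|/ltW yn] := leP 0 y.
  have := H (- y); rewrite oppr_ge0 cosN sinN mulrNN !sqrrN => /(_ yn).
  by have -> : (- y) ^+ 4 = y ^+ 4 by ring.
have s := sin_ge_cubic y0; have c := cos_ge_quadratic y0.
have : y * (y - sin y) <= y * (y ^+ 3 / 2) by rewrite ler_wpM2l.
have -> : y ^+ 4 = y * y ^+ 3 by ring.
nra.
Qed.

(** Cauchy-Schwarz against the constant vector, by induction: [key] completes the square for one
    more term. *)
Lemma sqn_sum_le (k : nat) (F : 'I_k -> R[i]) :
  sqn (\sum_(s < k) F s) <= k%:R * \sum_(s < k) sqn (F s).
Proof.
elim: k F => [|k IH] F; first by rewrite !big_ord0 sqn0 mul0r.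
rewrite !big_ord_recr /=; have := IH (fun s => F (widen_ord (leqnSn k) s)).
have : k = 0%N -> \sum_(s < k) F (widen_ord (leqnSn k) s) = 0.
  by move=> k0; rewrite big1// => -[s sk]; exfalso; rewrite k0 in sk.
have : 0 <= \sum_(s < k) sqn (F (widen_ord (leqnSn k) s)).
  by apply: sumr_ge0 => *; exact: sqn_ge0.
set S := \sum_(s < k) F _; set T := \sum_(s < k) sqn _; set x := F ord_max => T0 S0 ST.
have [k0|k0] := posnP k; first by rewrite S0// k0 add0r mul1r lerDr.
have k0R : 0 < (k%:R : R) by rewrite ltr0n.
rewrite -(ler_pM2l k0R) -natr1.
have key : k%:R * sqn (S + x) = (k%:R + 1) * sqn S + k%:R * (k%:R + 1) * sqn x
    - sqn (S - k%:R%:C * x).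
  by case: (S) => a b; case: (x) => c d; rewrite /sqn /=; ring.
have := sqn_ge0 (S - k%:R%:C * x).
have : (k%:R + 1) * sqn S <= (k%:R + 1) * (k%:R * T) by rewrite ler_wpM2l//; lra.
lra.
Qed.

(** With [y = x / k], both sides are [k]-th powers of points of the unit disc at distance at most
    [y ^+ 2]. *)
Lemma normc_cis_resolvent_power (x : R) (k : nat) : (0 < k)%N ->
  normc (cisN x - ((1 +i* (x / k%:R))^-1) ^+ k) <= x ^+ 2 / k%:R.
Proof.
move=> k0; have kR : (k%:R : R) != 0 by rewrite pnatr_eq0 -lt0n.
set y := x / k%:R; have xE : x = k%:R * y by rewrite /y mulrC divfK.
have b0 : (1 +i* y) != 0 by rewrite eq_complex /= oner_eq0.
have sb : sqn (1 +i* y)^-1 <= 1 ^+ 2.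
  rewrite sqnV /sqn /= expr1n invf_le1; first by rewrite lerDl sqr_ge0.
  by rewrite ltr_pwDl// sqr_ge0.
rewrite {1}xE cisN_expn.
apply: le_trans (ler_normc_subX k _ _) _.
- by rewrite normc_le// sqn_cisN expr1n.
- by rewrite normc_le.
have -> : x ^+ 2 / k%:R = k%:R * y ^+ 2 by rewrite /y; field.
rewrite ler_wpM2l// normc_le ?sqr_ge0//.
have -> : cisN y - (1 +i* y)^-1 = ((1 +i* y) * cisN y - 1) * (1 +i* y)^-1.
  by rewrite mulrBl mul1r mulrAC divff// mul1r.
rewrite sqnM; have := sqn_cis_resolvent y; have := sqn_ge0 ((1 +i* y) * cisN y - 1).
have := sqn_ge0 (1 +i* y)^-1; have -> : (y ^+ 2) ^+ 2 = y ^+ 4 by ring.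
rewrite expr1n in sb; nra.
Qed.

Lemma onem_expX_le (A : R) (k : nat) : (0 < k)%N -> 0 <= A <= k%:R ->
  (1 - A / k%:R) ^+ k <= expR (- A).
Proof.
move=> k0 /andP[A0 Ak]; have k0R : 0 < (k%:R : R) by rewrite ltr0n.
have -> : - A = k%:R * (- (A / k%:R)) by field; rewrite gt_eqF.
rewrite expRM_natl lerXn2r ?nnegrE ?expR_ge0//.
  by rewrite subr_ge0 ler_pdivrMr// mul1r.
exact: expR_ge1Dx.
Qed.

Lemma onem_expVX_le (A : R) (k n : nat) : (0 < k)%N -> (n <= k)%N -> 0 <= A -> 2 * A <= k%:R ->
  ((1 - A / k%:R)^-1) ^+ n <= expR (2 * A).
Proof.
move=> k0 nk A0 Ak; have k0R : 0 < (k%:R : R) by rewrite ltr0n.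
set a := A / k%:R; have a0 : 0 <= a by rewrite divr_ge0// ltW.
have a2 : 2 * a <= 1 by rewrite /a mulrA ler_pdivrMr// mul1r.
have a1 : 0 < 1 - a by lra.
apply: (@le_trans _ _ (expR (2 * a) ^+ n)).
  rewrite lerXn2r ?nnegrE ?expR_ge0 ?invr_ge0 ?(ltW a1)//.
  apply: le_trans (expR_ge1Dx _); rewrite -[X in X <= _]mul1r ler_pdivrMr//; nra.
rewrite -expRM_natl ler_expR.
have -> : 2 * A = k%:R * (2 * a) by rewrite /a; field; rewrite gt_eqF.
by rewrite ler_wpM2r ?ler_nat//; lra.
Qed.

End Cis.

(** * Approximation of [e^{-itl}] by sums of simple poles *)

Section RationalApproximation.
Variable R : realType.
Notation normc := (@Normc.normc R).

Lemma normc_prim_root (w : R[i]) (k : nat) : k.-primitive_root w -> normc w = 1.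
Proof.
move=> wk; apply/eqP; rewrite -(@pexpr_eq1 _ _ k) ?normc_ge0 ?(prim_order_gt0 wk)//.
by rewrite -normcX (prim_expr_order wk) Normc.normc1.
Qed.

(* Subtracting [(i (1 - A / k))^k] from the denominator of [(1 + itl/k)^-k]
   splits its pole of order [k] into [k] simple poles on a circle. *)
Lemma cis_rational_approx (A t : R) (k : nat) :
  (0 < k)%N -> 0 < t -> 1 <= A -> 2 * A <= k%:R ->
  exists (gam z : 'I_k -> R[i]),
  [/\ forall s, sqn (gam s) <= (expR (2 * A) / t) ^+ 2,
      forall s, A / t <= complex.Im (z s) &
      forall l : R, normc (cisN (t * l) - \sum_(s < k) gam s * (l%:C - z s)^-1)
        <= (t * l) ^+ 2 / k%:R + 2 * expR (- A)].
Proof.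
move=> k0 t0 A1 Ak.
have kR : 0 < (k%:R : R) by rewrite ltr0n.
have kC : (k%:R : R[i]) != 0 by rewrite pnatr_eq0 -lt0n.
have [w wk] := prim_root_exists kC.
have wn (s : nat) : normc (w ^+ s) = 1 by rewrite normcX (normc_prim_root wk) expr1n.
(* The poles lie on the circle of radius [r] about the point of height [y] on the imaginary axis,
   hence at height at least [y - r = A / t]. *)
pose y := k%:R / t; have y0 : 0 < y by rewrite divr_gt0.
pose rho := 1 - A / k%:R.
have rho0 : 0 < rho by rewrite subr_gt0 ltr_pdivrMr//; lra.
have rho1 : rho <= 1 by rewrite gerBl divr_ge0 ?ltW//; lra.
pose r := y * rho; have r0 : 0 < r by rewrite mulr_gt0.
pose iy : R[i] := 0 -i* y.
have iy0 : iy != 0 by rewrite eq_complex /= oppr_eq0 (gt_eqF y0) andbF.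
have rC0 : r%:C != 0 :> R[i] by rewrite eq_complex /= gt_eqF.
pose z (s : 'I_k) : R[i] := (0 +i* y) + r%:C * w ^+ s.
pose C0 : R[i] := iy ^+ k / (k%:R * r%:C ^+ k.-1).
pose gam (s : 'I_k) : R[i] := C0 * w ^+ s.
exists gam, z; split.
- move=> s; rewrite -normc_le ?divr_ge0 ?expR_ge0 ?(ltW t0)//.
  rewrite /gam /C0 !Normc.normcM wn mulr1 Normc.normcV Normc.normcM !normcX normc_real.
  have -> : normc iy = y by rewrite /iy /= expr0n add0r sqrrN sqrtr_sqr gtr0_norm.
  have -> : normc (k%:R : R[i]) = k%:R
    by rewrite -[k%:R]/((k%:R : R[i])) -(rmorph_nat (real_complex R)) normc_real gtr0_norm.
  rewrite gtr0_norm// -[in y ^+ k](prednK k0) exprS /r [(y * rho) ^+ _]exprMn.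
  have -> : y * y ^+ k.-1 / (k%:R * (y ^+ k.-1 * rho ^+ k.-1)) = (rho^-1) ^+ k.-1 / t.
    have : y ^+ k.-1 != 0 by rewrite expf_neq0// gt_eqF.
    have : rho ^+ k.-1 != 0 by rewrite expf_neq0// gt_eqF.
    rewrite exprVn; move: (rho ^+ _) (y ^+ _) => P Y P0 Y0; rewrite /y; field.
    by rewrite P0 Y0 gt_eqF//= gt_eqF.
  rewrite ler_pM2r ?invr_gt0// onem_expVX_le//; first exact: leq_pred.
  lra.
- move=> s; rewrite /z /=.
  have -> : A / t = y - r by rewrite /r /rho /y; field; rewrite ?(gt_eqF t0) ?(gt_eqF kR).
  have : normc (w ^+ s) <= 1 by rewrite wn.
  rewrite normc_le// expr1n /sqn; case: (w ^+ s) => a b /= ab.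
  have b1 : - 1 <= b by have := sqr_ge0 a; nra.
  have : r * - 1 <= r * b by rewrite ler_pM2l.
  by move=> h; rewrite mul0r addr0; lra.
(* By partial fractions the sum is [(b ^+ k - th)^-1] with [|b ^+ k| >= 1] and
   [|th| <= expR (- A) <= 1 / 2]; replacing it by [(b ^+ k)^-1] costs at most [2 * expR (- A)]. *)
move=> l; pose x := t * l.
pose b : R[i] := 1 +i* (x / k%:R); pose th : R[i] := (0 +i* rho) ^+ k.
have nth : normc th <= expR (- A).
  rewrite /th normcX /= expr0n add0r sqrtr_sqr gtr0_norm// onem_expX_le//; lra.
have eA : expR (- A) <= 2^-1.
  rewrite expRN lef_pV2 ?posrE ?expR_gt0//.
  by apply: le_trans (expR_ge1Dx _); lra.
have nb : 1 <= normc (b ^+ k).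
  rewrite normcX exprn_ege1// -(@ler_pXn2r _ 2)// ?nnegrE ?normc_ge0//.
  by rewrite normc_sqr /sqn /b /= expr1n lerDl sqr_ge0.
have nbt : 2^-1 <= normc (b ^+ k - th).
  have := le_normcD (b ^+ k - th) th; rewrite subrK; lra.
have bt0 : b ^+ k - th != 0.
  by apply: contraTneq nbt => ->; rewrite Normc.normc0 -ltNge invr_gt0.
have bk0 : b ^+ k != 0.
  by apply: contraTneq nb => ->; rewrite Normc.normc0 -ltNge.
have Xr : (l%:C - (0 +i* y)) = iy * b.
  apply/eqP; rewrite eq_complex /iy /b /x /y /=; apply/andP; split; apply/eqP; field.
    by rewrite ?(gt_eqF t0) ?(gt_eqF kR).
  by rewrite ?(gt_eqF t0) ?(gt_eqF kR).
have rE : r%:C = iy * (0 +i* rho).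
  by apply/eqP; rewrite eq_complex /iy /r /=; apply/andP; split; apply/eqP; ring.
have XrE : (l%:C - (0 +i* y)) ^+ k - r%:C ^+ k = iy ^+ k * (b ^+ k - th).
  by rewrite Xr rE !exprMn -mulrBr.
have XrN : (l%:C - (0 +i* y)) ^+ k != r%:C ^+ k.
  by rewrite -subr_eq0 XrE mulf_neq0// expf_neq0.
have -> : \sum_(s < k) gam s * (l%:C - z s)^-1 = (b ^+ k - th)^-1.
  transitivity (C0 * \sum_(s < k) w ^+ s / ((l%:C - (0 +i* y)) - r%:C * w ^+ s)).
    rewrite mulr_sumr; apply: eq_bigr => s _; rewrite /gam /z -mulrA.
    by congr (_ * (_ * _^-1)); ring.
  rewrite (partial_fractions_unity wk XrN) XrE /C0.
  have : iy ^+ k != 0 by rewrite expf_neq0.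
  have : r%:C ^+ k.-1 != 0 by rewrite expf_neq0.
  move: (iy ^+ k) (r%:C ^+ k.-1) (b ^+ k - th) bt0 => Y P Q Q0 P0 Y0.
  by field; rewrite Q0 Y0 P0.
have -> : cisN (t * l) - (b ^+ k - th)^-1
   = (cisN x - (b^-1) ^+ k) + ((b ^+ k)^-1 - (b ^+ k - th)^-1).
  by rewrite exprVn /x; ring.
apply: le_trans (le_normcD _ _) _; apply: lerD; first exact: normc_cis_resolvent_power.
have -> : (b ^+ k)^-1 - (b ^+ k - th)^-1 = - th * ((b ^+ k)^-1 * (b ^+ k - th)^-1).
  have inv_sub (X Y : R[i]) : X != 0 -> X - Y != 0 -> X^-1 - (X - Y)^-1 = - Y * (X^-1 * (X - Y)^-1).
    by move=> X0 XY0; field; rewrite X0 XY0.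
  exact: inv_sub.
rewrite !Normc.normcM normcN !Normc.normcV.
have h1 : (normc (b ^+ k))^-1 <= 1 by rewrite invf_le1// (lt_le_trans _ nb).
have h2 : (normc (b ^+ k - th))^-1 <= 2.
  by rewrite -[2]invrK lef_pV2 ?posrE ?invr_gt0// (lt_le_trans _ nbt)// invr_gt0.
have h3 : 0 <= (normc (b ^+ k))^-1 by rewrite invr_ge0 normc_ge0.
have h4 : 0 <= (normc (b ^+ k - th))^-1 by rewrite invr_ge0 normc_ge0.
rewrite [2 * _]mulrC; apply: ler_pM => //; rewrite ?normc_ge0 ?mulr_ge0//.
by rewrite -[2]mul1r ler_pM.
Qed.

End RationalApproximation.

(** * Decay of the approximate evolution on truncations *)

Section TruncatedEvolution.
Variable R : realType.
Notation normc := (@Normc.normc R).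

Lemma resolvent_decay_arith (e h B D G : R) : 0 < e <= 1 -> e <= h -> 0 < B -> B <= D ->
  0 <= G -> 2 * h ^+ 4 * D * G <= 1 + h ^+ 2 -> G <= (e ^+ 4 * B)^-1.
Proof.
move=> /andP[e0 e1] eh B0 BD G0 hG.
have h0 : 0 < h by exact: lt_le_trans eh.
have e2h : e ^+ 2 <= h ^+ 2 by rewrite ler_pXn2r// nnegrE ltW.
have e2 : e ^+ 2 <= 1 by rewrite exprn_ile1// ltW.
have e20 : 0 < e ^+ 2 by exact: exprn_gt0.
have h20 : 0 < h ^+ 2 by exact: exprn_gt0.
rewrite -div1r ler_pdivlMr ?mulr_gt0 ?exprn_gt0//.
have h4 : (1 + h ^+ 2) * e ^+ 4 <= 2 * h ^+ 4.
  have -> : e ^+ 4 = e ^+ 2 * e ^+ 2 by ring.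
  have -> : h ^+ 4 = h ^+ 2 * h ^+ 2 by ring.
  move: e2h e2 e20 h20; move: (e ^+ 2) (h ^+ 2) => E H EH E1 E0 H0.
  have a1 : E * E <= H * H by rewrite ler_pM// ltW.
  have a2 : E * E <= H by apply: le_trans EH; rewrite ger_pMl.
  have a3 : H * (E * E) <= H * H by rewrite ler_pM2l.
  lra.
have h40 : 0 < 2 * h ^+ 4 by rewrite mulr_gt0 ?exprn_gt0.
rewrite -(ler_pM2l h40) mulr1.
have h5 : 2 * h ^+ 4 * (G * B) <= 2 * h ^+ 4 * (D * G).
  by rewrite ler_pM2l// mulrC ler_wpM2r.
have h6 : 2 * h ^+ 4 * (G * B) * e ^+ 4 <= (1 + h ^+ 2) * e ^+ 4.
  apply: ler_wpM2r; last by lra.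
  by rewrite exprn_ge0// ltW.
lra.
Qed.

(** All poles have height at least [A / t >= eps], where [resolvent_rep] gives decay; Cauchy-Schwarz
    over the [k] poles supplies the factor [k]. The function [f] is independent of [L], so that [L]
    may later tend to infinity. *)
Lemma truncated_evolution (V : nat -> R) (K eps B A t : R) (q k : nat) :
  0 < eps <= 1 -> (0 < q)%N -> 0 < B ->
  (forall x h, eps <= h -> B <= sqn (trace_poly V q).[x +i* h]) ->
  0 < t -> eps * t <= A -> 1 <= A -> (0 < k)%N -> 2 * A <= k%:R ->
  exists2 f : R -> R[i],
    forall l, normc (cisN (t * l) - f l) <= (t * l) ^+ 2 / k%:R + 2 * expR (- A) &
    forall L lam c, @spectral_rep R V K L lam c -> (q < L)%N ->
      \sum_(q.+1 <= n < L) sqn (\sum_j f (lam j) * c j n.+1)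
        <= (k%:R * (expR (2 * A) / t)) ^+ 2 * (eps ^+ 4 * B)^-1.
Proof.
move=> /andP[eps0 eps1] q0 B0 DB t0 etA A1 k0 Ak.
have [gam [z [gamP zP fP]]] := cis_rational_approx k0 t0 A1 Ak.
exists (fun l => \sum_(s < k) gam s * (l%:C - z s)^-1); first exact: fP.
move=> L lam c [lamK ceig ctot _] qL.
have etz s : eps <= complex.Im (z s).
  by apply: le_trans (zP s); rewrite ler_pdivlMr.
have Gs s : \sum_(q.+1 <= n < L) sqn (\sum_j ((lam j)%:C - z s)^-1 * c j n.+1)
   <= (eps ^+ 4 * B)^-1.
  have h0 : 0 < complex.Im (z s) by exact: lt_le_trans (etz s).
  have := resolvent_rep ceig ctot h0; move/(_ q); rewrite q0 qL => /(_ isT).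
  apply: resolvent_decay_arith => //; first by rewrite eps0.
    by have := DB (complex.Re (z s)) _ (etz s); case: (z s).
  by apply: sumr_ge0 => *; exact: sqn_ge0.
set g2 := (expR (2 * A) / t) ^+ 2 in gamP.
apply: (@le_trans _ _ (\sum_(q.+1 <= n < L)
    (k%:R * \sum_(s < k) (g2 * sqn (\sum_j ((lam j)%:C - z s)^-1 * c j n.+1))))).
  apply: ler_sum => n _.
  have -> : \sum_j (\sum_(s < k) gam s * ((lam j)%:C - z s)^-1) * c j n.+1
     = \sum_(s < k) gam s * \sum_j ((lam j)%:C - z s)^-1 * c j n.+1.
    under eq_bigr do rewrite mulr_suml.
    rewrite exchange_big /=; apply: eq_bigr => s _.
    by rewrite mulr_sumr; apply: eq_bigr => j _; rewrite mulrA.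
  apply: le_trans (sqn_sum_le _) _; rewrite ler_wpM2l//.
  by apply: ler_sum => s _; rewrite sqnM ler_wpM2r ?sqn_ge0.
rewrite -mulr_sumr exchange_big /=.
under eq_bigr do rewrite -mulr_sumr.
apply: (@le_trans _ _ (k%:R * \sum_(s < k) g2 * (eps ^+ 4 * B)^-1)).
  rewrite ler_wpM2l//; apply: ler_sum => s _; rewrite ler_wpM2l// /g2 sqr_ge0//.
rewrite sumr_const card_ord -[X in _ * X <= _]mulr_natl /g2.
by rewrite le_eqVlt; apply/orP; left; apply/eqP; ring.
Qed.

End TruncatedEvolution.

(** * Amplitudes on the half line as limits over truncations *)

Section Amplitude.
Variable R : realType.
Notation normc := (@Normc.normc R).

Lemma cvg_complex (s : nat -> R[i]) (a b : R) :
  (fun n => complex.Re (s n)) @ \oo --> a ->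
  (fun n => complex.Im (s n)) @ \oo --> b ->
  (s : nat -> R[i]^o) @ \oo --> (a +i* b : R[i]^o).
Proof.
move=> sa sb; apply/cvgrPdist_lt => e e0.
have [e1 e1_gt0 ->] : exists2 e1 : R, 0 < e1 & e = e1%:C.
  by move: e0; case: e => x y; rewrite ltcE /= => /andP[/eqP -> x0]; exists x.
have e2 : 0 < e1 / 2 by rewrite divr_gt0.
have := (cvgrPdist_lt _ _).1 sb _ e2; have := (cvgrPdist_lt _ _).1 sa _ e2.
move=> Ha Hb; near=> n.
have h1 : `|a - complex.Re (s n)| < e1 / 2 by near: n; exact: Ha.
have h2 : `|b - complex.Im (s n)| < e1 / 2 by near: n; exact: Hb.
have -> : `|(a +i* b : R[i]^o) - s n| = (normc ((a +i* b) - s n))%:C by [].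
rewrite ltcR; case: (s n) h1 h2 => x y /= h1 h2.
have -> : (a - x) ^+ 2 + (b - y) ^+ 2 = sqn ((a - x) +i* (b - y)) by [].
rewrite -normc_sqr sqrtr_sqr ger0_norm ?normc_ge0//.
have -> : (a - x) +i* (b - y) = (a - x)%:C + 'i * (b - y)%:C.
  by rewrite [LHS]complexE.
apply: le_lt_trans (le_normcD _ _) _.
have -> : e1 = e1 / 2 + e1 / 2 by field.
rewrite Normc.normcM !normc_real.
have -> : normc 'i = 1 by rewrite /= expr0n add0r expr1n sqrtr1.
by rewrite mul1r ltrD.
Unshelve. all: by end_near.
Qed.

Lemma normr_Re_Im_le (z : R[i]) : `|complex.Re z| <= normc z /\ `|complex.Im z| <= normc z.
Proof.
case: z => a b /=; rewrite -!sqrtr_sqr; split; apply: ler_wsqrtr.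
  by rewrite lerDl sqr_ge0.
by rewrite lerDr sqr_ge0.
Qed.

Section PowerSeries.
Variables (w : nat -> R[i]) (X : R).
Hypothesis wX : forall k, normc (w k) <= exp_coeff X k.

Lemma is_cvg_series_Re : cvgn (series (fun k => complex.Re (w k))).
Proof.
apply: normed_cvg; apply: (@series_le_cvg _ _ (exp_coeff X)) => [n|n|n|].
- exact: normr_ge0.
- by apply: le_trans (wX n); exact: normc_ge0.
- by apply: le_trans (wX n); have [] := normr_Re_Im_le (w n).
- exact: is_cvg_series_exp_coeff.
Qed.

Lemma is_cvg_series_Im : cvgn (series (fun k => complex.Im (w k))).
Proof.
apply: normed_cvg; apply: (@series_le_cvg _ _ (exp_coeff X)) => [n|n|n|].
- exact: normr_ge0.
- by apply: le_trans (wX n); exact: normc_ge0.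
- by apply: le_trans (wX n); have [] := normr_Re_Im_le (w n).
- exact: is_cvg_series_exp_coeff.
Qed.

Lemma Re_sum (I : Type) (s : seq I) (F : I -> R[i]) :
  complex.Re (\sum_(i <- s) F i) = \sum_(i <- s) complex.Re (F i).
Proof.
elim: s => [|i s IH]; first by rewrite !big_nil.
by rewrite !big_cons -IH; case: (F i) => a b; case: (\sum_(j <- s) F j).
Qed.

Lemma Im_sum (I : Type) (s : seq I) (F : I -> R[i]) :
  complex.Im (\sum_(i <- s) F i) = \sum_(i <- s) complex.Im (F i).
Proof.
elim: s => [|i s IH]; first by rewrite !big_nil.
by rewrite !big_cons -IH; case: (F i) => a b; case: (\sum_(j <- s) F j).
Qed.

Definition complex_sum : R[i] :=
  limn (series (fun k => complex.Re (w k))) +i* limn (series (fun k => complex.Im (w k))).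

Lemma limn_complex_series : limn (series (w : nat -> R[i]^o)) = complex_sum.
Proof.
apply: cvg_lim; first exact: norm_hausdorff.
apply: cvg_complex.
  by under eq_fun do rewrite /series /= Re_sum; exact: is_cvg_series_Re.
by under eq_fun do rewrite /series /= Im_sum; exact: is_cvg_series_Im.
Qed.

Lemma cvg_sqn_series (z : R[i]) :
  (fun m => sqn (\sum_(0 <= k < m) w k - z)) @ \oo --> sqn (complex_sum - z).
Proof.
have -> : (fun m => sqn (\sum_(0 <= k < m) w k - z)) =
  (fun m => (series (fun k => complex.Re (w k)) m - complex.Re z) ^+ 2
     + (series (fun k => complex.Im (w k)) m - complex.Im z) ^+ 2).
  apply/funext => m; rewrite /series /= -Re_sum -Im_sum.
  by case: (\sum_(0 <= k < m) w k) => a b; case: z.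
have -> : sqn (complex_sum - z) =
  (limn (series (fun k => complex.Re (w k))) - complex.Re z) ^+ 2
     + (limn (series (fun k => complex.Im (w k))) - complex.Im z) ^+ 2.
  by case: z.
have cR := is_cvg_series_Re; have cI := is_cvg_series_Im.
apply: cvgD; apply: cvgM; apply: cvgB => //; exact: cvg_cst.
Qed.

Lemma normc_sum_le (I : Type) (s : seq I) (F : I -> R[i]) :
  normc (\sum_(i <- s) F i) <= \sum_(i <- s) normc (F i).
Proof.
elim: s => [|i s IH]; first by rewrite !big_nil Normc.normc0.
by rewrite !big_cons (le_trans (le_normcD _ _))// lerD2l.
Qed.

Lemma exp_coeff_bound_ge0 n : 0 <= exp_coeff X n.
Proof. by apply: le_trans (wX n); exact: normc_ge0. Qed.

Lemma sqn_series_tail (m : nat) :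
  sqn (complex_sum - \sum_(0 <= k < m) w k) <= (expR X - series (exp_coeff X) m) ^+ 2.
Proof.
set B := (X in _ <= X).
apply: (@ler_cvg_to nat \oo _ R _ (fun=> B) _ _
  (@cvg_sqn_series (\sum_(0 <= k < m) w k)) (cvg_cst _)).
near=> m'; have mm' : (m <= m')%N by near: m'; exact: nbhs_infty_ge.
have nd : nondecreasing_seq (series (exp_coeff X)).
  by apply: nondecreasing_series => n _ _; exact: exp_coeff_bound_ge0.
have lim_ge n : series (exp_coeff X) n <= expR X.
  by apply: nondecreasing_cvgn_le => //; exact: is_cvg_series_exp_coeff.
rewrite -normc_le ?subr_ge0//.
rewrite (big_cat_nat (leq0n m) mm') /= addrAC subrr add0r.
apply: le_trans (normc_sum_le _ _) _.
apply: (@le_trans _ _ (\sum_(m <= k < m') exp_coeff X k)); first by apply: ler_sum.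
have := lim_ge m'; rewrite {1}/series /= (big_cat_nat (leq0n m) mm') /= /series /=.
by rewrite lerBrDl.
Unshelve. all: by end_near.
Qed.

End PowerSeries.

Definition cis_term (x : R) (k : nat) : R[i] := (0 -i* x) ^+ k / k`!%:R.

Lemma normc_natr n : normc (n%:R : R[i]) = n%:R.
Proof. by rewrite -(rmorph_nat (real_complex R)) normc_real ger0_norm. Qed.

Lemma normc_cis_term (x : R) k : normc (cis_term x k) = exp_coeff `|x| k.
Proof.
rewrite /cis_term Normc.normcM normcX Normc.normcV normc_natr.
by rewrite /= expr0n add0r sqrrN sqrtr_sqr.
Qed.

(** The right side has the shape of [cos_coeff] and [sin_coeff], which makes the comparison of
    coefficients immediate. *)
Lemma imaginary_expr (x : R) k : (0 -i* x) ^+ k =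
  ((~~ odd k)%:R * (-1) ^+ k./2 * x ^+ k) -i* ((odd k)%:R * (-1) ^+ k.-1./2 * x ^+ k).
Proof.
have two (y : R) : (0 -i* y) ^+ 2 = (- y ^+ 2)%:C.
  by apply/eqP; rewrite eq_complex /=; apply/andP; split; apply/eqP; ring.
have ev n : (0 -i* x) ^+ n.*2 = ((-1) ^+ n * x ^+ n.*2)%:C.
  rewrite -mul2n exprM two -rmorphXn /=; congr (_%:C).
  by rewrite exprM -exprMn mulN1r.
case: (boolP (odd k)) => ok.
  rewrite -[in LHS](odd_double_half k) ok add1n exprS ev mul0r mul0r.
  have -> : k.-1./2 = k./2 by rewrite -[in LHS](odd_double_half k) ok add1n /= doubleK.
  rewrite [x ^+ k](_ : _ = x * x ^+ (k./2).*2); last first.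
    by rewrite -exprS -[in LHS](odd_double_half k) ok add1n.
  by apply/eqP; rewrite eq_complex /=; apply/andP; split; apply/eqP; ring.
have kE : k = (k./2).*2 by rewrite -[LHS](odd_double_half k) (negPf ok).
rewrite [in LHS]kE ev -kE mul1r !mul0r oppr0.
by [].
Qed.

Lemma natr_realC n : (n%:R : R[i]) = (n%:R : R)%:C.
Proof. by rewrite rmorph_nat. Qed.

Lemma Re_cis_term x k : complex.Re (cis_term x k) = cos_coeff x k.
Proof.
rewrite /cis_term imaginary_expr natr_realC -fmorphV /=.
by rewrite mulr0 subr0.
Qed.

Lemma Im_cis_term x k : complex.Im (cis_term x k) = - sin_coeff x k.
Proof.
rewrite /cis_term imaginary_expr natr_realC -fmorphV /=.
by rewrite mulr0 add0r mulNr.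
Qed.

Lemma cisN_sum (x : R) : complex_sum (cis_term x) = cisN x.
Proof.
rewrite /complex_sum /cisN cos.unlock sin.unlock; congr (_ +i* _).
  by under eq_fun do rewrite Re_cis_term.
under eq_fun do rewrite Im_cis_term.
rewrite -limN; last exact: is_cvg_series_sin_coeff.
by congr (lim (_ @ \oo)); apply/funext => n; rewrite /series /= sumrN.
Qed.

Lemma cisN_taylor (x X : R) (m : nat) : `|x| <= X ->
  sqn (cisN x - \sum_(0 <= k < m) cis_term x k)
    <= (expR X - series (exp_coeff X) m) ^+ 2.
Proof.
move=> xX; rewrite -cisN_sum; apply: sqn_series_tail => k.
rewrite normc_cis_term /exp_coeff /= ler_wpM2r ?invr_ge0//.
by rewrite lerXn2r ?nnegrE// (le_trans _ xX).
Qed.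

Section Evolution.
Variables (V : nat -> R) (M : R).
Hypothesis VM : forall n, (0 < n)%N -> `|V n| <= M.

Lemma bound_ge0 : 0 <= M. Proof. by apply: le_trans (VM (ltn0Sn 0)). Qed.

Definition moment k n := iter k (schrodinger V) (delta R 1) n.

(** On the truncation to [n + k] sites, which computes the moment exactly, every eigenvalue has
    modulus at most [M + 2]. *)
Lemma normc_moment k n : (0 < n)%N -> normc (moment k n) <= (M + 2) ^+ k.
Proof.
move=> n0; have K0 : 0 <= M + 2 by rewrite addr_ge0// bound_ge0.
have [lam [c [lamK ceig ctot cnorm]]] := spectral_rep_exists (ltn_addr k n0) VM.
rewrite /moment -(moment_rep ceig ctot)// normc_le ?exprn_ge0//.
have lamk j : sqn ((lam j)%:C ^+ k) <= ((M + 2) ^+ k) ^+ 2.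
  by rewrite -normc_le ?exprn_ge0// normcX normc_real lerXn2r ?nnegrE.
apply: le_trans (cnorm (fun j => (lam j)%:C ^+ k) _ lamk).
have nn : (n.-1 < n + k)%N by rewrite (leq_trans _ (leq_addr _ _)) ?prednK.
rewrite (big_rem n.-1) ?mem_index_iota//= prednK// lerDl.
by apply: sumr_ge0 => *; exact: sqn_ge0.
Qed.

Lemma normc_evolution_term t k n : (0 < n)%N ->
  normc (cis_term t k * moment k n) <= exp_coeff (`|t| * (M + 2)) k.
Proof.
move=> n0; rewrite Normc.normcM normc_cis_term /exp_coeff /= exprMn mulrAC.
by rewrite ler_wpM2r ?invr_ge0// ler_wpM2l ?exprn_ge0// normc_moment.
Qed.

Lemma amplitudeE t n : (0 < n)%N ->
  amplitude V t n = complex_sum (fun k => cis_term t k * moment k n).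
Proof.
by move=> n0; exact: (limn_complex_series (fun k => normc_evolution_term t k n0)).
Qed.

(** Partial sums of the exponential series are exact on a large truncation, where they are split
    into [f] and an error controlled through the spectrum; then the number of terms tends to
    infinity. *)
Lemma evolution_bound (t be ga : R) (f : R -> R[i]) (N1 N2 : nat) :
  0 <= t -> 0 <= ga ->
  (forall l, `|l| <= M + 2 -> sqn (cisN (t * l) - f l) <= be) ->
  (forall L lam c, @spectral_rep R V (M + 2) L lam c -> (N2 < L)%N ->
     \sum_(N1 <= n < L) sqn (\sum_j f (lam j) * c j n.+1) <= ga) ->
  \sum_(N1 <= n < N2) sqn (amplitude V t n.+1) <= 4 * be + 2 * ga.
Proof.
move=> t0 ga0 fbe fga; pose X := t * (M + 2).
have X0 : 0 <= X by rewrite mulr_ge0// addr_ge0// bound_ge0.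
have tX : `|t| * (M + 2) = X by rewrite ger0_norm.
pose S m n := \sum_(0 <= k < m) cis_term t k * moment k n.+1.
have cS : (fun m => \sum_(N1 <= n < N2) sqn (S m n)) @ \oo -->
    \sum_(N1 <= n < N2) sqn (amplitude V t n.+1).
  apply: cvg_big => [|n _]; first exact: add_continuous.
  rewrite amplitudeE//.
  have := @cvg_sqn_series _ _ (fun k => normc_evolution_term t k (ltn0Sn n)) 0.
  by rewrite subr0; under eq_fun do rewrite subr0.
(* This bounds the squared tail of the exponential series after [m] terms and tends to 0. *)
pose del m := (expR X - series (exp_coeff X) m) ^+ 2.
have cdel : (fun m => 2 * (2 * be + 2 * del m) + 2 * ga) @ \oo --> 2 * (2 * be + 2 * 0) + 2 * ga.
  apply: cvgD; last exact: cvg_cst.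
  apply: cvgM; first exact: cvg_cst; apply: cvgD; first exact: cvg_cst.
  apply: cvgM; first exact: cvg_cst.
  have -> : 0 = (expR X - expR X) ^+ 2 :> R by rewrite subrr expr0n.
  rewrite /del; apply: cvgM; apply: cvgB; try exact: cvg_cst; exact: is_cvg_series_exp_coeff.
have -> : 4 * be + 2 * ga = 2 * (2 * be + 2 * 0) + 2 * ga by ring.
apply: (ler_cvg_to cS cdel); near=> m.
(* With this many sites the first [m] terms of the series are exact at all sites up to [N2]. *)
have L0 : (0 < m + N2.+1)%N by rewrite addnS.
have [lam [c rep]] := spectral_rep_exists L0 VM.
have [lamK ceig ctot cnorm] := rep.
pose E (l : R) := \sum_(0 <= k < m) cis_term (t * l) k.
have SE n : (n < N2)%N -> S m n = \sum_j E (lam j) * c j n.+1.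
  move=> nN; rewrite /S /E; under [RHS]eq_bigr do rewrite mulr_suml.
  rewrite exchange_big /=; apply: eq_big_nat => k /andP[_ km].
  rewrite /moment -(moment_rep ceig ctot)//; last by lia.
  rewrite mulr_sumr; apply: eq_bigr => j _; rewrite mulrA; congr (_ * _).
  rewrite /cis_term; have -> : 0 -i* (t * lam j) = (0 -i* t) * (lam j)%:C.
    by apply/eqP; rewrite eq_complex /=; apply/andP; split; apply/eqP; ring.
  by rewrite exprMn mulrAC.
have NL : (N2 <= m + N2.+1)%N by rewrite (leq_trans (leqnSn _)) ?leq_addl.
have N2L : (N2 < m + N2.+1)%N by lia.
have dm : forall j, sqn (E (lam j) - f (lam j)) <= 2 * be + 2 * del m.
  move=> j; have -> : E (lam j) - f (lam j) =
    (cisN (t * lam j) - f (lam j)) + (E (lam j) - cisN (t * lam j)) by ring.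
  apply: le_trans (sqnD _ _) _; apply: lerD; rewrite ler_pM2l//; first exact: fbe.
  rewrite -sqnN opprB; apply: cisN_taylor.
  by rewrite normrM ger0_norm// ler_wpM2l.
have le1 : \sum_(N1 <= n < N2) sqn (S m n) <=
    \sum_(N1 <= n < N2) (2 * sqn (\sum_j (E (lam j) - f (lam j)) * c j n.+1)
       + 2 * sqn (\sum_j f (lam j) * c j n.+1)).
  apply: ler_sum_nat => n /andP[_ nN]; rewrite SE//.
  have -> : \sum_j E (lam j) * c j n.+1 = \sum_j (E (lam j) - f (lam j)) * c j n.+1
      + \sum_j f (lam j) * c j n.+1.
    by rewrite -big_split; apply: eq_bigr => j _ /=; ring.
  exact: sqnD.
apply: le_trans le1 _; rewrite big_split /= -!mulr_sumr.
have extend (F : nat -> R) (a b : nat) : (a <= N1)%N -> (N2 <= b)%N ->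
    (forall n, 0 <= F n) -> \sum_(N1 <= n < N2) F n <= \sum_(a <= n < b) F n.
  move=> aN Nb F0; have [N12|N21] := leqP N1 N2; last first.
    by rewrite big_geq ?(ltnW N21)// sumr_ge0.
  rewrite (big_cat_nat aN (leq_trans N12 Nb)) /= (big_cat_nat N12 Nb) /=.
  by rewrite addrCA lerDl addr_ge0 ?sumr_ge0.
apply: lerD; rewrite ler_pM2l//.
  apply: le_trans (extend _ 0%N (m + N2.+1)%N _ _ _)
    (cnorm (fun j => E (lam j) - f (lam j)) _ dm) => //.
  by move=> n; exact: sqn_ge0.
apply: le_trans (extend _ N1 (m + N2.+1)%N _ _ _) (fga _ _ _ rep N2L) => //.
by move=> n; exact: sqn_ge0.
Unshelve. all: by end_near.
Qed.

End Evolution.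
End Amplitude.

(** * Time averages and the outside probability *)

Section TimeAverage.
Variable R : realType.
Notation mu := (@lebesgue_measure R).
Notation D := (`[0%R, +oo[%classic : set R).

Lemma measurable_expRM (c : R) : measurable_fun D (EFin \o (fun t : R => expR (c * t))).
Proof.
by apply/measurable_EFinP; apply: measurableT_comp => //.
Qed.

Lemma integral_expR_decay (c : R) : 0 < c ->
  (\int[mu]_(t in D) (expR (- c * t))%:E = (c^-1)%:E)%E.
Proof.
move=> c0; have := integral_exponential_pdf c0.
have -> : (\int[mu]_x (exponential_pdf c x)%:E =
    \int[mu]_(x in D) (c%:E * (expR (- c * x))%:E))%E.
  rewrite [RHS]integral_mkcond; apply: eq_integral => x _.
  by rewrite /exponential_pdf !patchE; case: ifP.
rewrite ge0_integralZl_EFin//; [|exact: measurable_expRM|exact: ltW].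
move=> e; have := congr1 (fun y => (c^-1)%:E * y)%E e.
by rewrite muleA -EFinM mulVf ?gt_eqF// mul1e mule1.
Qed.

Section Bound.
Variables (V : nat -> R) (M : R).
Hypothesis VM : forall n, (0 < n)%N -> `|V n| <= M.

(** The partial sums of the power series are polynomial in [t], and measurability passes to the
    pointwise limit. *)
Lemma measurable_amplitude n (S : set R) : (0 < n)%N ->
  measurable_fun S (fun t => sqn (amplitude V t n)).
Proof.
move=> n0; apply: measurable_funTS.
apply: (@measurable_fun_cvg _ _ _ _
   (fun m t => sqn (\sum_(0 <= k < m) cis_term t k * moment V k n))); last first.
  move=> t _; rewrite (amplitudeE VM)//.
  have := @cvg_sqn_series _ _ _ (fun k => normc_evolution_term VM t k n0) 0.
  by rewrite subr0; under eq_fun do rewrite subr0.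
move=> m.
have mc k : measurable_fun setT (fun t : R => cos_coeff t k).
  by apply: measurable_funM; [apply: measurable_funM;
    [exact: measurable_cst|exact: measurable_funX]|exact: measurable_cst].
have ms k : measurable_fun setT (fun t : R => sin_coeff t k).
  by apply: measurable_funM; [apply: measurable_funM;
    [exact: measurable_cst|exact: measurable_funX]|exact: measurable_cst].
apply: measurable_funD; apply: measurable_funX.
  under eq_fun do rewrite Re_sum; apply: measurable_sum => k.
  have -> : (fun t => complex.Re (cis_term t k * moment V k n)) =
     (fun t => cos_coeff t k * complex.Re (moment V k n)
       + sin_coeff t k * complex.Im (moment V k n)).
    apply/funext => t; rewrite -Re_cis_term -[sin_coeff t k]opprK -Im_cis_term.
    by case: (cis_term t k) => a b; case: (moment V k n) => c d /=; ring.
  by apply: measurable_funD; apply: measurable_funM => //; exact: measurable_cst.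
under eq_fun do rewrite Im_sum; apply: measurable_sum => k.
have -> : (fun t => complex.Im (cis_term t k * moment V k n)) =
   (fun t => cos_coeff t k * complex.Im (moment V k n) - sin_coeff t k * complex.Re (moment V k n)).
  apply/funext => t; rewrite -Re_cis_term -[sin_coeff t k]opprK -Im_cis_term.
  by case: (cis_term t k) => a b; case: (moment V k n) => c d /=; ring.
by apply: measurable_funB; apply: measurable_funM => //; exact: measurable_cst.
Qed.

Lemma integral_majorant (c1 c2 c3 t0 T : R) :
  0 <= c1 -> 0 <= c2 -> 0 <= c3 -> 0 <= t0 -> 0 < T ->
  (\int[mu]_(t in D) (c1 * \1_(`[0%R, t0]%classic) t + (c2 * expR (- (2 / T) * t)
      + c3 * expR (- (T^-1) * t)))%:E = (c1 * t0 + (c2 * (T / 2) + c3 * T))%:E)%E.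
Proof.
move=> c10 c20 c30 t00 T0.
have mI : measurable_fun D (EFin \o (\1_(`[0%R, t0]%classic) : R -> R)).
  by apply/measurable_EFinP; exact: measurable_indic.
have Ex c : (0 <= c)%R -> forall t : R, D t -> (0 <= (expR (c * t))%:E)%E.
  by move=> _ t _; rewrite lee_fin expR_ge0.
have mE (a c : R) : measurable_fun D (fun t : R => (a%:E * (expR (c * t))%:E)%E).
  by apply: measurable_funeM; exact: measurable_expRM.
under eq_integral do rewrite EFinD [(_ * _ + _ * _)%:E]EFinD !EFinM.
rewrite ge0_integralD//=; last 4 first.
- by move=> t _; rewrite -EFinM lee_fin mulr_ge0.
- exact: measurable_funeM.
- by move=> t _; rewrite -!EFinM -EFinD lee_fin addr_ge0// mulr_ge0// expR_ge0.
- by apply: emeasurable_funD; exact: mE.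
rewrite [X in (_ + X)%E]ge0_integralD//=; last 4 first.
- by move=> t _; rewrite -EFinM lee_fin mulr_ge0// expR_ge0.
- exact: mE.
- by move=> t _; rewrite -EFinM lee_fin mulr_ge0// expR_ge0.
- exact: mE.
rewrite !ge0_integralZl_EFin//; [|exact: measurable_expRM..].
rewrite !integral_expR_decay ?invr_gt0 ?divr_gt0// integral_indic//.
have -> : (`[0%R, t0]%classic `&` D) = `[0%R, t0]%classic.
  by apply/setIidl => x /=; rewrite !in_itv/= => /andP[->].
have muI : lebesgue_measure (`[0%R, t0]%classic : set R) = t0%:E.
  rewrite lebesgue_measure_itv /= lte_fin.
  by case: ltP => [_|t0_le]; rewrite ?sube0//; congr _%:E; apply/eqP; rewrite eq_le t00 t0_le.
rewrite [X in (_ * X + _)%E](_ : _ = t0%:E) ?invrK ?invf_div//.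
Qed.

(** Time is cut at [t0] and [tau]: the bound 4 serves before [t0], [s] in between, and after [tau]
    the bound 4 with [e^{-2t/T} <= e^{-tau/T} e^{-t/T}]. *)
Lemma outside_prob_le (q : nat) (Q T t0 tau s : R) :
  0 < T -> 0 <= t0 -> 0 <= s -> q.+1%:R <= Q ->
  (forall t N, 0 <= t -> \sum_(q.+1 <= n < N) sqn (amplitude V t n.+1) <= 4) ->
  (forall t N, 0 <= t -> t0 <= t <= tau ->
     \sum_(q.+1 <= n < N) sqn (amplitude V t n.+1) <= s) ->
  (outside_prob V Q T <= (8 * t0 / T + s + 8 * expR (- (tau / T)))%:E)%E.
Proof.
move=> T0 t00 s0 qQ all_t mid_t.
have T2 : 0 <= 2 / T by rewrite divr_ge0// ltW.
rewrite /outside_prob; apply: lime_le.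
  apply: is_cvg_nneseries => n _ _; rewrite mule_ge0// integral_ge0// => t _.
  by rewrite lee_fin mulr_ge0 ?sqr_ge0 ?expR_ge0.
near=> N.
rewrite big_add1 -big_filter.
set I := [seq n <- _ | _].
rewrite -ge0_sume_distrr; last first.
  by move=> n _; apply: integral_ge0 => t _; rewrite lee_fin mulr_ge0 ?sqr_ge0 ?expR_ge0.
pose F n t := (sqn (amplitude V t n.+1) * expR (- (2 / T) * t))%:E.
have mF n : measurable_fun D (F n).
  apply/measurable_EFinP; apply: measurable_funM; first exact: measurable_amplitude.
  by apply/measurable_EFinP; exact: measurable_expRM.
have F0 n t : D t -> (0 <= F n t)%E by move=> _; rewrite lee_fin mulr_ge0 ?sqn_ge0 ?expR_ge0.
have -> : (\sum_(n <- I) \int[mu]_(t in D)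
    (Normc.normc (amplitude V t n.+1) ^+ 2 * expR (- 2 * t / T))%:E)%E
  = (\int[mu]_(t in D) \sum_(n <- I) F n t)%E.
  rewrite ge0_integral_sum//; apply: eq_bigr => n _; apply: eq_integral => t _.
  by rewrite /F normc_sqr; congr (_ * expR _)%:E; ring.
have maj : (\int[mu]_(t in D) \sum_(n <- I) F n t <=
   (4 * t0 + (s * (T / 2) + (4 * expR (- (tau / T))) * T))%:E)%E.
  rewrite -integral_majorant ?mulr_ge0 ?expR_ge0//; apply: ge0_le_integral => //.
  - by move=> t Dt; apply: sume_ge0 => n _; exact: F0.
  - exact: emeasurable_sum.
  - apply/measurable_EFinP; apply: measurable_funD.
      by apply: measurable_funM => //; exact: measurable_indic.
    by apply: measurable_funD; apply: measurable_funM; rewrite -?measurable_EFinP;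
      try exact: measurable_cst; exact: measurable_expRM.
  move=> t; rewrite /= in_itv/= andbT => tge0.
  rewrite sumEFin lee_fin -mulr_suml.
  (* After the shift the site is [n.+1]; [Q < n.+1] and [q.+1 <= Q] give [n >= q.+1]. *)
  have IS : \sum_(n <- I) sqn (amplitude V t n.+1) <=
     \sum_(q.+1 <= n < N.-1) sqn (amplitude V t n.+1).
    rewrite /I big_filter [leRHS](big_nat_widenl _ 0)//= big_mkcond [leRHS]big_mkcond.
    apply: ler_sum => n _; case: ifP => [Qn|_]; last by case: ifP => // _; exact: sqn_ge0.
    have : (q < n)%N by have := le_lt_trans qQ Qn; rewrite ltr_nat ltnS.
    by move=> ->.
  have e0 := expR_ge0 (- (2 / T) * t).
  have i0 : 0 <= (\1_(`[0%R, t0]%classic) t : R) by [].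
  have e1 := expR_ge0 (- T^-1 * t); have e2 := expR_ge0 (- (tau / T)).
  have P1 : 0 <= s * expR (- (2 / T) * t) by rewrite mulr_ge0.
  have P2 : 0 <= 4 * expR (- (tau / T)) * expR (- T^-1 * t) by rewrite !mulr_ge0.
  apply: (@le_trans _ _ ((\sum_(q.+1 <= n < N.-1) sqn (amplitude V t n.+1))
    * expR (- (2 / T) * t))).
    by rewrite ler_wpM2r.
  have [tt0|t0t] := leP t t0.
    have -> : \1_(`[0%R, t0]%classic) t = 1 :> R.
      by rewrite indicE mem_set//= in_itv/= tge0.
    rewrite mulr1.
    apply: (@le_trans _ _ 4); last by lra.
    rewrite -[leRHS]mulr1 ler_pM//; first by apply: sumr_ge0 => *; exact: sqn_ge0.
      exact: all_t.
    by rewrite -[leRHS]expR0 ler_expR mulNr oppr_le0 mulr_ge0.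
  have [ttau|taut] := leP t tau.
    apply: (@le_trans _ _ (s * expR (- (2 / T) * t))); last by lra.
    by rewrite ler_wpM2r// mid_t// ttau ltW.
  apply: (@le_trans _ _ (4 * expR (- (tau / T)) * expR (- T^-1 * t))); last by lra.
  rewrite -mulrA -expRD ler_pM//; first by apply: sumr_ge0 => *; exact: sqn_ge0.
    exact: all_t.
  rewrite ler_expR.
  have -> : - (tau / T) + - T^-1 * t = - (tau / T) - t / T by ring.
  have -> : - (2 / T) * t = - (t / T) - t / T by ring.
  by rewrite lerD2r lerN2 ler_pM2r ?invr_gt0// ltW.
apply: (@le_trans _ _ ((2 / T)%:E * (4 * t0 + (s * (T / 2) + (4 * expR (- (tau / T))) * T))%:E)%E).
  by rewrite lee_wpmul2l// lee_fin.
rewrite -EFinM lee_fin le_eqVlt; apply/orP; left; apply/eqP.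
by field; rewrite gt_eqF.
Unshelve. all: by end_near.
Qed.

End Bound.
End TimeAverage.

(** * Exponential smallness from a lower bound on the trace *)

Section Quantitative.
Variable R : realType.
Variables (V : nat -> R) (M : R).
Hypothesis VM : forall n, (0 < n)%N -> `|V n| <= M.

(* The cut-off times [expR (- A)] and [A / eps] and the number of poles, of
   order [expR A] times a power of [A / eps], make all the errors decay like
   [expR (- A)]. *)
Lemma outside_prob_trace (eps A Q T : R) (q : nat) :
  0 < eps <= 1 -> 1 <= A -> (0 < q)%N -> q.+1%:R <= Q -> 1 <= T -> T * eps <= 1 ->
  (forall x h, eps <= h -> expR (10 * A) <= sqn (trace_poly V q).[x +i* h]) ->
  (outside_prob V Q T <=
     (52 * expR (- A) + 8 * ((A / eps * (M + 2)) ^+ 2 + 2 * A + 1) ^+ 2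
        * (eps ^+ 4)^-1 * expR (- (2 * A)))%:E)%E.
Proof.
move=> eps01 A1 q0 qQ T1 Te trace; have /andP[eps0 eps1] := eps01.
have K0 : 0 < M + 2 by have := bound_ge0 VM; lra.
have A0 : 0 < A by lra.
set X := A / eps * (M + 2); set W := X ^+ 2 + 2 * A + 1.
have X0 : 0 <= X by rewrite !mulr_ge0 ?invr_ge0 ?ltW.
have W1 : 1 <= W by rewrite /W; have := sqr_ge0 X; lra.
pose E := expR A; have E1 : 1 <= E by rewrite /E -[leLHS]expR0 ler_expR ltW.
have E0 : 0 < E by lra.
have EW0 : 0 <= E * W by rewrite mulr_ge0; lra.
(* The lower bound on [k] makes the error [X ^+ 2 / k] at most [expR (- A)]; the upper bound limits
   the cost of having [k] poles. *)
have [k [k0 kge kle]] : exists k : nat, [/\ (0 < k)%N, E * W <= k%:R & k%:R <= 2 * (E * W)].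
  exists (Num.truncn (E * W)).+1; split => //; first by rewrite ltW// truncnS_gt.
  have EW1 : 1 <= E * W by rewrite -[leLHS]mul1r ler_pM.
  have : (Num.truncn (E * W))%:R <= E * W by rewrite truncn_le.
  rewrite -natr1; lra.
have kR : 0 < k%:R :> R by rewrite ltr0n.
have kA : 2 * A <= k%:R.
  apply: le_trans kge; have := sqr_ge0 X; rewrite /W; nra.
have Einv : expR (- A) = E^-1 by rewrite expRN.
have B0 : 0 < expR (10 * A) by exact: expR_gt0.
pose s := 4 * (3 * E^-1) ^+ 2
  + 2 * ((k%:R * (expR (2 * A) * E)) ^+ 2 * (eps ^+ 4 * expR (10 * A))^-1).
have e40 : 0 < eps ^+ 4 * expR (10 * A) by rewrite mulr_gt0 ?exprn_gt0.
have s0 : 0 <= s.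
  by rewrite /s addr_ge0// mulr_ge0// ?sqr_ge0// mulr_ge0 ?sqr_ge0// invr_ge0 ltW.
have := @outside_prob_le R V M VM q Q T E^-1 (A / eps) s.
have -> : 0 < T by lra.
have -> : 0 <= E^-1 by rewrite invr_ge0 ltW.
move=> /(_ isT isT s0 qQ) main.
apply: le_trans (main _ _) _.
(* The comparison function 0 is within 1 of [cisN], so [be = 1] and [ga = 0] give the bound 4. *)
- move=> t N t0; have := @evolution_bound R V M VM t 1 0 (fun=> 0) q.+1 N t0 (lexx 0).
  rewrite mulr0 addr0 mulr1; apply.
    by move=> l _; rewrite subr0 sqn_cisN.
  move=> L lam c _ _; rewrite big1// => n _; rewrite big1 ?sqn0// => j _.
  by rewrite mul0r.
- move=> t N t0 /andP[Et tA].
  have tpos : 0 < t by apply: lt_le_trans Et; rewrite invr_gt0.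
  have etA : eps * t <= A by rewrite mulrC -ler_pdivlMr.
  have [f fP fV] := truncated_evolution (M + 2) eps01 q0 B0 trace tpos etA A1 k0 kA.
  have := @evolution_bound R V M VM t ((3 * E^-1) ^+ 2)
    ((k%:R * (expR (2 * A) * E)) ^+ 2 * (eps ^+ 4 * expR (10 * A))^-1) f q.+1 N t0.
  apply.
  + by rewrite mulr_ge0 ?sqr_ge0// invr_ge0 ltW.
  + move=> l lK; rewrite -normc_le ?mulr_ge0 ?invr_ge0 ?(ltW E0)//.
    apply: le_trans (fP l) _; rewrite Einv.
    have tl : (t * l) ^+ 2 <= X ^+ 2.
      rewrite -(real_normK (num_real (t * l))) ler_pXn2r ?nnegrE// normrM gtr0_norm//.
      by rewrite /X ler_pM// ltW.
    have : (t * l) ^+ 2 / k%:R <= E^-1; last by lra.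
    rewrite ler_pdivrMr// [E^-1 * _]mulrC ler_pdivlMr//; apply: le_trans kge.
    by rewrite [_ * E]mulrC ler_pM2l// (le_trans tl)// /W; lra.
  move=> L lam c rep NL.
  have [qL|Lq] := ltnP q L; last first.
    rewrite big_geq; first by rewrite mulr_ge0 ?sqr_ge0// invr_ge0 ltW.
    by rewrite (leq_trans Lq).
  apply: le_trans (fV _ _ _ rep qL) _.
  rewrite ler_wpM2r ?invr_ge0 ?(ltW e40)// ler_pXn2r ?nnegrE ?mulr_ge0 ?invr_ge0
    ?expR_ge0 ?(ltW tpos) ?(ltW E0)//.
  rewrite ler_pM2l// ler_pM2l ?expR_gt0//.
  by rewrite -[leRHS]invrK lef_pV2 ?posrE ?invr_gt0.
rewrite lee_fin.
have h1 : 8 * E^-1 / T <= 8 * E^-1.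
  rewrite ler_pdivrMr ?(lt_le_trans _ T1)// ler_peMr// mulr_ge0// invr_ge0 ltW//.
have h2 : expR (- (A / eps / T)) <= E^-1.
  rewrite -Einv ler_expR lerN2 -mulrA -invfM; apply: ler_peMr; first exact: ltW.
  have T0 : 0 < T by lra.
  by rewrite invf_ge1 ?mulr_gt0// mulrC.
have h3 : E^-1 ^+ 2 <= E^-1.
  by rewrite expr2 ler_piMl ?invr_ge0 ?(ltW E0)// invf_le1.
have E2 : expR (2 * A) = E ^+ 2 by rewrite -[2]/(2%:R) expRM_natl.
have E10 : expR (10 * A) = E ^+ 10 by rewrite -[10]/(10%:R) expRM_natl.
(* [k ^ 2] is of order [e^{2A} W^2], the coefficients and the bound [e^A] on [1 / t] contribute
   [e^{6A}], and the [e^{10A}] from the trace leaves [e^{-2A}]. *)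
have h4 : (k%:R * (expR (2 * A) * E)) ^+ 2 * (eps ^+ 4 * expR (10 * A))^-1
   <= 4 * W ^+ 2 * (eps ^+ 4)^-1 * expR (- (2 * A)).
  apply: (@le_trans _ _ ((2 * (E * W) * (expR (2 * A) * E)) ^+ 2 * (eps ^+ 4 * expR (10 * A))^-1)).
    have F0 : 0 <= expR (2 * A) * E by rewrite mulr_ge0 ?expR_ge0 ?ltW.
    have F1 : k%:R * (expR (2 * A) * E) <= 2 * (E * W) * (expR (2 * A) * E) by rewrite ler_wpM2r.
    rewrite ler_wpM2r ?invr_ge0 ?(ltW e40)//; apply: lerXn2r => //; rewrite nnegrE mulr_ge0//.
    by rewrite mulr_ge0.
  rewrite expRN E2 E10 le_eqVlt; apply/orP; left; apply/eqP.
  by field; rewrite !gt_eqF.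
(* The constant 52 is 8 from the short times, 36 from the approximation error and 8 from the long
   times. *)
rewrite Einv /s.
have -> : (3 * E^-1) ^+ 2 = 9 * E^-1 ^+ 2 by ring.
lra.
Qed.

End Quantitative.

(** * The outside probability under clustering *)

Section Clustered.
Variable R : realType.
Variables (V : nat -> R) (M : R).
Hypothesis VM : forall n, (0 < n)%N -> `|V n| <= M.

Lemma expR_five_fourths (n : nat) : expR (n%:R / 5) <= (5 / 4 : R) ^+ n.
Proof.
have h : 4 / 5 <= expR (- (5^-1)) :> R by apply: le_trans (expR_ge1Dx _); lra.
have h' : expR (5^-1) <= 5 / 4 :> R.
  rewrite -[leLHS]invrK -expRN -[leRHS]invrK lef_pV2 ?posrE ?expR_gt0//; lra.
by rewrite expRM_natl lerXn2r ?nnegrE ?expR_ge0// (le_trans _ h') ?expR_ge0.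
Qed.

(** With [n] within 2 of [y = q^delta], [clustered_trace_ge] makes [(D + 4) ^ 2] at least of order
    [e^{y/5}]. Claiming only [e^{y/20}] for [D] leaves a factor [e^{y/10}], which absorbs the
    constants when [y >= 200]. *)
Lemma clustered_trace_expR (q : nat) (eps delta xi h x : R) (S : {fset interval R}) :
  (1 < q)%N -> delta < xi -> 200 <= q%:R `^ delta -> 0 < eps -> eps <= h ->
  clustered V q eps xi S ->
  expR (q%:R `^ delta / 20) <= sqn (trace_poly V q).[x +i* h].
Proof.
move=> q1 dxi; set y := q%:R `^ delta => y200 eps0 eh cl.
have h0 : 0 < h by exact: lt_le_trans eh.
have [n ny yn] : exists2 n : nat, n%:R < y & y < n%:R + 2.
  have y0 : 0 <= y by lra.
  have := truncn_itv y0; case: (Num.truncn y) => [|n] /andP[h1 h2].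
    by exfalso; move: h2; rewrite ltNge => /negP; apply; lra.
  exists n; first by apply: lt_le_trans h1; rewrite ltr_nat.
  by move: h2; rewrite -[n.+2]addn2 natrD.
have nxi : n%:R < q%:R `^ xi.
  by apply: lt_le_trans ny _; rewrite ler_powR ?ler1n ?(ltW dxi)// ltnW.
have := clustered_trace_ge x (ltnW q1) cl nxi h0 eh.
set D := sqn _ => DD; rewrite leNgt; apply/negP => Dlt.
have D0 : 0 <= D by exact: sqn_ge0.
set G := expR (y / 20) in Dlt.
have G1 : 1 <= G by rewrite /G -[leLHS]expR0 ler_expR; lra.
have : (D + 4) ^+ 2 < 25 * G ^+ 2.
  have -> : 25 * G ^+ 2 = (5 * G) ^+ 2 by ring.
  by rewrite ltr_pXn2r ?nnegrE//; lra.
move=> /(le_lt_trans DD); rewrite ltNge => /negP; apply.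
apply: (@le_trans _ _ (4 * expR (n%:R / 5))); last by rewrite ler_pM2l// expR_five_fourths.
have -> : G ^+ 2 = expR (y / 10) by rewrite /G -expRM_natl; congr expR; field.
have -> : n%:R / 5 = y / 10 + (n%:R / 5 - y / 10) by ring.
rewrite expRD; have := expR_ge1Dx (n%:R / 5 - y / 10).
have := expR_gt0 (y / 10); set a := expR _; set b := expR _ => a0 b1.
have : 19 <= b by lra.
nra.
Qed.

(** Taking [A = y / 200] makes [10 * A] the exponent [y / 20] of [clustered_trace_expR]. The
    remaining prefactor is bounded by a power of [y], and one of the two factors [expR (- A)]
    absorbs it. The constant serves all [q], [alpha] and [xi]. *)
Lemma clustered_outside_prob (delta : R) : 0 < delta ->
  exists2 C0 : R, 0 < C0 &
  forall (q : nat) (alpha xi T Q : R) (S : {fset interval R}),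
    (1 < q)%N -> clustered V q (q%:R `^ (- alpha^-1)) xi S ->
    delta < xi -> delta < alpha < 1 -> 200 <= q%:R `^ delta ->
    q.+1%:R <= Q -> 1 <= T <= q%:R `^ alpha^-1 ->
    (outside_prob V Q T <= (C0 * expR (- (q%:R `^ delta / 200)))%:E)%E.
Proof.
move=> d0; pose K := M + 2.
(* This gives [1 / eps = q^(1/alpha) <= q^(1/delta) = y^(1/delta^2) <= y^m], uniformly in
   [alpha]. *)
have [m dm] : exists m : nat, delta^-1 * delta^-1 <= m%:R.
  by exists (Num.truncn (delta^-1 * delta^-1)).+1; rewrite ltW// truncnS_gt.
(* The degree in [y] of the prefactor: [W ^+ 2] accounts for [2 (2m + 2)] and [eps ^- 4] for [4m].
   The successor form fits the Taylor bound [expR_ge1Dxn]. *)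
have [N NE] : exists N, N.+1 = ((2 * m + 2) * 2 + m * 4)%N.
  by exists (8 * m + 3)%N; lia.
pose C1 := (K ^+ 2 + 3) ^+ 2.
pose C0 := 52 + 8 * C1 * (200 ^+ N.+1 * N.+1`!%:R).
exists C0.
  have C10 : 0 <= C1 by exact: sqr_ge0.
  have P0 : 0 <= (200 : R) ^+ N.+1 * N.+1`!%:R by exact: mulr_ge0 (exprn_ge0 _ _) (ler0n _ _).
  by rewrite /C0; have := mulr_ge0 C10 P0; lra.
move=> q alpha xi T Q S q1 cl dxi /andP[da a1]; set y := q%:R `^ delta => y200 qQ /andP[T1 Tq].
have qR : 1 <= q%:R :> R by rewrite ler1n ltnW.
have q0 : 0 < q%:R :> R by lra.
have al0 : 0 < alpha by lra.
pose eps : R := q%:R `^ (- alpha^-1).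
have eps0 : 0 < eps by exact: powR_gt0.
have epsV : eps^-1 = q%:R `^ alpha^-1 by rewrite /eps powRN invrK.
have epsV1 : 1 <= eps^-1.
  by rewrite epsV -[leLHS](powRr0 q%:R) ler_powR// invr_ge0 ltW.
have eps1 : eps <= 1 by rewrite -[leLHS]invrK invf_le1// invr_gt0.
pose A := y / 200.
have A1 : 1 <= A by rewrite /A; lra.
have := @outside_prob_trace R V M VM eps A Q T q.
rewrite eps0 eps1 => /(_ isT A1 (ltnW q1) qQ T1) h; apply: le_trans (h _ _) _ => {h}.
- by rewrite -ler_pdivlMr// div1r epsV.
- move=> x h eh; have -> : 10 * A = y / 20 by rewrite /A; field.
  exact: (clustered_trace_expR x q1 dxi y200 eps0 eh cl).
rewrite lee_fin -/A.
have y1 : 1 <= y by lra.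
have epsy : eps^-1 <= y ^+ m.
  have dV : 0 < delta^-1 by rewrite invr_gt0.
  rewrite epsV; apply: (@le_trans _ _ (q%:R `^ delta^-1)).
    by rewrite ler_powR// lef_pV2 ?posrE// ltW.
  have -> : delta^-1 = delta * (delta^-1 * delta^-1) by field; rewrite gt_eqF.
  rewrite powRrM -/y -powR_mulrn ?(le_trans ler01)//.
  by rewrite ler_powR.
have ep0 : 0 <= eps^-1 by lra.
have K0 : 0 <= K by have := bound_ge0 VM; rewrite /K; lra.
set W := _ + 2 * A + 1.
have W0 : 0 <= W by rewrite /W !addr_ge0 ?sqr_ge0//; lra.
have ym : 1 <= y ^+ m by rewrite exprn_ege1.
have WW : W <= (K ^+ 2 + 3) * y ^+ (2 * m + 2).
  have -> : y ^+ (2 * m + 2) = (y * y ^+ m) ^+ 2.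
    by rewrite exprD mulnC exprM exprMn mulrC.
  have Y1 : y <= y * y ^+ m by rewrite ler_peMr//; lra.
  have Y2 : y * y ^+ m <= (y * y ^+ m) ^+ 2 by rewrite expr2 ler_peMr//; lra.
  have : (A / eps * K) ^+ 2 <= (y * y ^+ m * K) ^+ 2.
    rewrite lerXn2r ?nnegrE ?mulr_ge0//; try lra.
    by rewrite ler_wpM2r// ler_pM//; rewrite /A; lra.
  rewrite /W -/K exprMn; rewrite /A; lra.
have W2 : W ^+ 2 * (eps ^+ 4)^-1 <= C1 * y ^+ N.+1.
  have -> : y ^+ N.+1 = (y ^+ (2 * m + 2)) ^+ 2 * (y ^+ m) ^+ 4.
    by rewrite NE exprD !exprM.
  rewrite mulrA /C1 -exprMn -exprVn ler_pM ?exprn_ge0//.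
  - by rewrite lerXn2r ?nnegrE// (le_trans W0).
  - by rewrite lerXn2r ?nnegrE// (le_trans ep0).
have yA : y ^+ N.+1 <= 200 ^+ N.+1 * N.+1`!%:R * expR A.
  have -> : y = 200 * A by rewrite /A; field.
  rewrite exprMn -mulrA ler_wpM2l ?exprn_ge0//.
  have A0 : 0 <= A by lra.
  have h := expR_ge1Dxn N A0; rewrite [leRHS]mulrC -ler_pdivrMr ?ltr0n ?fact_gt0//.
  by move: h; lra.
have e0 := expR_gt0 (- A).
have eA : expR (- (2 * A)) = expR (- A) * expR (- A) by rewrite -expRD; congr expR; ring.
have eAA : expR A * expR (- A) = 1 by rewrite -expRD subrr expR0.
set P := 200 ^+ N.+1 * N.+1`!%:R in C0 yA *.
have key : W ^+ 2 * (eps ^+ 4)^-1 * expR (- (2 * A)) <= C1 * P * expR (- A).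
  apply: (@le_trans _ _ (C1 * (P * expR A) * (expR (- A) * expR (- A)))).
    rewrite eA ler_wpM2r ?mulr_ge0 ?expR_ge0//; apply: le_trans W2 _.
    by rewrite ler_wpM2l// sqr_ge0.
  rewrite le_eqVlt; apply/orP; left; apply/eqP.
  transitivity (C1 * P * (expR A * expR (- A)) * expR (- A)); first by ring.
  by rewrite eAA mulr1.
rewrite /C0 [leRHS]mulrDl lerD2l.
have -> : 8 * W ^+ 2 * (eps ^+ 4)^-1 * expR (- (2 * A))
  = 8 * (W ^+ 2 * (eps ^+ 4)^-1 * expR (- (2 * A))) by ring.
by rewrite -[8 * C1 * P]mulrA -[leRHS]mulrA ler_pM2l.
Qed.

End Clustered.

(** * Limits inferior and superior, and logarithmic ratios *)

Section Limits.
Variable R : realType.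

Lemma limf_einf_bounded_below (f : R -> \bar R) :
  (-oo < limf_einf f +oo%R)%E ->
  exists M0 m : R, forall T, M0 < T -> (m%:E <= f T)%E.
Proof.
rewrite /limf_einf lteNr /= => /ereal_inf_lt[_ [A [M0 [_ MA]] <-]] sup_lt.
have [r supr] : exists r : R, (ereal_sup [set (- f T)%E | T in A] <= r%:E)%E.
  move: sup_lt; case: (ereal_sup _) => [r _|//|_]; first by exists r.
  by exists 0; exact: leNye.
exists M0, (- r) => T MT; rewrite EFinN leeNl; apply: le_trans supr.
by apply: ereal_sup_ubound; exists T => //; exact: MA.
Qed.

Lemma limf_esup_eqNy (f : R -> \bar R) :
  (forall m : R, exists M0, forall T, M0 < T -> (f T <= m%:E)%E) ->
  limf_esup f +oo%R = -oo%E.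
Proof.
move=> fm; have le_m m : (limf_esup f +oo%R <= m%:E)%E.
  have [M0 fM0] := fm m; apply: (@le_trans _ _ (ereal_sup (f @` [set T | M0 < T]))).
    by apply: ereal_inf_lbound; exists [set T | M0 < T] => //;
      exists M0; split => //; exact: num_real.
  by apply: ge_ereal_sup => _ [T MT <-]; exact: fM0.
move: le_m; case: (limf_esup _ _) => [r| |//] le_m.
  by exfalso; have := le_m (r - 1)%R; rewrite lee_fin; lra.
by have := le_m 0%R.
Qed.

Lemma limn_einf_ge (u : nat -> R) (a : R) (n : nat) :
  (forall l, (n <= l)%N -> a <= u l) -> (a%:E <= limn_einf (fun l => (u l)%:E))%E.
Proof.
move=> au; rewrite /limn_einf leeNr.
apply: (@le_trans _ _ (ereal_sup [set (- (u l)%:E)%E | l in [set l | (n <= l)%N]])).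
  by apply: ereal_inf_lbound; exists [set l | (n <= l)%N] => //; exists n.
by apply: ge_ereal_sup => _ [l nl <-]; rewrite -!EFinN lee_fin lerN2 au.
Qed.

Lemma limn_esup_gt_eventually (u : nat -> R) (a : R) :
  (limn_esup (fun l => (u l)%:E) < a%:E)%E ->
  exists n, forall l, (n <= l)%N -> u l < a.
Proof.
move=> /ereal_inf_lt[_ [A [n _ nA] <-]] supa.
exists n => l nl; rewrite -lte_fin; apply: le_lt_trans supa.
by apply: ereal_sup_ubound; exists l => //; exact: nA.
Qed.

Lemma lt_EFin_dense (x : \bar R) (a : R) : (x < a%:E)%E ->
  exists2 a' : R, a' < a & (x < a'%:E)%E.
Proof.
case: x => [r|//|_]; last by exists (a - 1); [lra|exact: ltNyr].
by rewrite lte_fin => ra; exists ((r + a) / 2); rewrite ?lte_fin; lra.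
Qed.

(** With [u = T^(b/2)] one has [u^2 <= y] and [ln T <= (2/b) u], so [y / 200] outweighs both [ln C0]
    and [|m| ln T] once [u >= 200 L]. *)
Lemma log_ratio_small (b C0 m : R) : 0 < b -> 0 < C0 ->
  exists2 T0, 1 < T0 & forall T y : R, T0 <= T -> T `^ b <= y ->
    200 <= y /\ forall P : \bar R, (P <= (C0 * expR (- (y / 200)))%:E)%E ->
      (lne P * ((ln T)^-1)%:E <= m%:E)%E.
Proof.
move=> b0 C00; pose L := `|ln C0| + `|m| * (2 / b) + 1.
have b2 : 0 < 2 / b by rewrite divr_gt0.
have L1 : 1 <= L by rewrite /L lerDr addr_ge0// mulr_ge0// ltW.
pose T0 := (200 * L) `^ (2 / b).
have T01 : 1 < T0.
  rewrite /T0 [ltLHS](_ : 1 = 1 `^ (2 / b)); last by rewrite powR1.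
  by rewrite gt0_ltr_powR ?nnegrE//; lra.
exists T0 => // T y TT0 Ty; have T1 : 1 < T by exact: lt_le_trans TT0.
pose u := T `^ (b / 2).
have uL : 200 * L <= u.
  have -> : 200 * L = T0 `^ (b / 2).
    rewrite /T0 -powRrM; have -> : 2 / b * (b / 2) = 1 by field; rewrite gt_eqF.
    by rewrite powRr1//; lra.
  rewrite /u ge0_ler_powR ?nnegrE//; lra.
have u2 : u ^+ 2 <= y.
  rewrite -powR_mulrn ?powR_ge0// /u -powRrM divfK ?pnatr_eq0//.
have lnT0 : 0 < ln T by rewrite ln_gt0.
have lnT : ln T <= 2 / b * u.
  have : ln u <= u by rewrite ltW// ln_sublinear// powR_gt0; lra.
  rewrite ln_powR => h; have : 2 / b * (b / 2 * ln T) <= 2 / b * u by rewrite ler_pM2l.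
  by have -> : 2 / b * (b / 2 * ln T) = ln T by field; rewrite gt_eqF.
split; first by nra.
move=> P Ple.
have Pln : (lne P <= (ln C0 - y / 200)%:E)%E.
  (* [lne] takes the value [-oo] at every nonpositive argument. *)
  have [P0|P0] := leP P 0%E; first by rewrite le0_lneNy// leNye.
  have lnE : (lne (C0 * expR (- (y / 200)))%:E = (ln C0 - y / 200)%:E)%E.
    by rewrite lne_EFin ?mulr_gt0 ?expR_gt0// lnM ?posrE ?expR_gt0// expRK.
  rewrite -lnE lee_lne// in_itv/= ?(ltW P0) ?leey//= lee_fin.
  by rewrite mulr_ge0 ?expR_ge0// ltW.
have key : ln C0 - y / 200 <= m * ln T.
  have h1 : - `|m| * ln T <= m * ln T by rewrite ler_pM2r// lerNl ler_normr lexx orbT.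
  have h2 : `|m| * ln T <= `|m| * (2 / b * u) by rewrite ler_wpM2l.
  have h3 : ln C0 <= `|ln C0| * u.
    by apply: le_trans (ler_norm _) _; rewrite ler_peMr//; lra.
  have h4 : 200 * L * u <= u * u by rewrite ler_wpM2r//; lra.
  have h5 : L * u = `|ln C0| * u + `|m| * (2 / b * u) + u by rewrite /L; ring.
  have u0 : 0 < u by lra.
  rewrite expr2 in u2; lra.
case: (lne P) Pln => [r| |] Pln //.
  rewrite -EFinM lee_fin ler_pdivrMr//; move: Pln; rewrite lee_fin; lra.
by rewrite gt0_mulNye ?leNye// lte_fin invr_gt0.
Qed.

Lemma cvgny_real (q : nat -> nat) (Q : R) : q l @[l --> \oo] --> \oo ->
  exists n, forall l, (n <= l)%N -> Q <= (q l)%:R.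
Proof.
move=> /cvgnyPge/(_ (Num.truncn `|Q|).+1)[n _ nq]; exists n => l nl.
have := nq l nl; rewrite /= -(ler_nat R); apply: le_trans.
by rewrite (le_trans (ler_norm Q))// ltW// truncnS_gt.
Qed.

End Limits.

(** * Comparison of the transport exponents with [alpha] *)

Section Exponents.
Variable R : realType.
Variables (V : nat -> R) (q : nat -> nat) (U : nat -> {fset interval R}).
Variables (alpha xi : nat -> R) (M delta : R).
Hypothesis VM : forall n, (0 < n)%N -> `|V n| <= M.
Hypothesis q1 : forall l, (1 < q l)%N.
Hypothesis q_infty : q l @[l --> \oo] --> \oo.
Hypothesis delta_gt0 : 0 < delta.
Hypothesis xi_alpha : forall l, delta < xi l /\ delta < alpha l < 1.
Hypothesis clusters : forall l, clustered V (q l) (scale q alpha l) (xi l) (U l).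

(** The conditions on [l] say that [q l] is at least a power of [T], that [T] is within the time
    scale of [q l], and that [T^a] lies beyond site [q l]. *)
Lemma log_ratio_le (b m a : R) : 0 < b ->
  exists2 T0, 1 < T0 & forall (T : R) l, T0 <= T ->
    T `^ b <= (q l)%:R `^ delta -> T <= (q l)%:R `^ (alpha l)^-1 ->
    (q l).+1%:R <= T `^ a -> (log_ratio V a T <= m%:E)%E.
Proof.
move=> b0; have [C0 C00 bound] := clustered_outside_prob VM delta_gt0.
have [T0 T01 small] := log_ratio_small m b0 C00.
exists T0 => // T l TT0 Ty Tq qT; have [y200 le_m] := small _ _ TT0 Ty.
have [dxi da] := xi_alpha l.
apply: le_m; apply: (bound (q l) (alpha l) (xi l) T _ (U l)) => //.
by rewrite Tq andbT (le_trans (ltW T01)).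
Qed.

Lemma powR_gap_ge (s x : R) : 1 < s -> 1 <= x -> 2 `^ (s - 1)^-1 <= x -> x + 1 <= x `^ s.
Proof.
move=> s1 x1 x2; have s0 : 0 < s - 1 by lra.
have : 2 <= x `^ (s - 1).
  have -> : 2 = (2 `^ (s - 1)^-1) `^ (s - 1) :> R.
    by rewrite -powRrM mulVf ?gt_eqF// powRr1.
  by rewrite ge0_ler_powR ?nnegrE ?powR_ge0//; lra.
have -> : x `^ s = x * x `^ (s - 1) by rewrite mulr_powRB1//; lra.
by nra.
Qed.

(** If [alpha l < a' < a] for arbitrarily large [l], then at the times [T = q^(1/alpha)] one has
    [T^a >= q^(a/a') >= q + 1], and the log-ratio falls below any bound. *)
Lemma le_limn_einf_of_einf (a : R) : 0 < a ->
  (-oo < limf_einf (log_ratio V a) +oo%R)%E ->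
  (a%:E <= limn_einf (fun l => (alpha l)%:E))%E.
Proof.
move=> a0 /limf_einf_bounded_below[M0 [m fm]].
rewrite leNgt; apply/negP => /lt_EFin_dense[a' a'a inf_lt].
have often n : exists2 l, (n <= l)%N & alpha l < a'.
  apply: contrapT => H; move: inf_lt; rewrite ltNge => /negP; apply.
  apply: (@limn_einf_ge _ _ _ n) => l nl; rewrite leNgt; apply/negP => la.
  by apply: H; exists l.
have a'0 : 0 < a'.
  have [l _ la] := often 0%N; have [_ /andP[da _]] := xi_alpha l.
  exact: lt_trans delta_gt0 (lt_trans da la).
have s1 : 1 < a / a' by rewrite ltr_pdivlMr// mul1r.
have d2 : 0 < delta ^+ 2 by rewrite exprn_gt0.
(* As [delta < alpha], such [T] satisfies [T^(delta^2) <= q^delta]; the target [m - 1] contradicts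
   the lower bound [m]. *)
have [T0 T01 lr] := @log_ratio_le (delta ^+ 2) (m - 1) a d2.
have [n nq] := cvgny_real (`|M0| + 1 + T0 + 2 `^ (a / a' - 1)^-1) q_infty.
have [l nl la'] := often n; have qbig := nq l nl.
have [_ /andP[da a1]] := xi_alpha l.
have al0 : 0 < alpha l by exact: lt_trans da.
have qR : 1 <= (q l)%:R :> R by rewrite ler1n ltnW.
pose T := (q l)%:R `^ (alpha l)^-1.
have qT : (q l)%:R <= T.
  by rewrite /T le1r_powR// invf_ge1// ltW.
have p0 := powR_ge0 2 (a / a' - 1)^-1; have M00 := ler_norm M0; have nM0 := normr_ge0 M0.
have /lr : T0 <= T by lra.
move=> /(_ l) H.
have : (log_ratio V a T <= (m - 1)%:E)%E.
  apply: H => //.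
  - by rewrite -powRrM ler_powR// mulrC ler_pdivrMr// expr2 ler_pM2l// ltW//.
  - apply: (@le_trans _ _ ((q l)%:R `^ (a / a'))).
      by rewrite -natr1 powR_gap_ge//; lra.
    by rewrite -powRrM ler_powR// mulrC ler_pM2r// lef_pV2 ?posrE// ltW//.
have : (m%:E <= log_ratio V a T)%E by apply: fm; lra.
by move=> h1 /(le_trans h1); rewrite lee_fin; lra.
Qed.

(** For each large [T] the last [l] with [q l + 1 <= T^a] is used. The growth bound gives
    [q l >= T^a'], hence [T <= (q l)^(1/a') <= (q l)^(1/alpha l)]. *)
Lemma le_limn_esup_of_esup (C a : R) : 0 < a ->
  (forall l, (q l.+1)%:R <= C * (q l)%:R) ->
  (-oo < limf_esup (log_ratio V a) +oo%R)%E ->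
  (a%:E <= limn_esup (fun l => (alpha l)%:E))%E.
Proof.
move=> a0 qC; rewrite leNgt => sup_gt; apply/negP.
move=> /lt_EFin_dense[a' a'a /limn_esup_gt_eventually[n0 n0P]].
suff eN : limf_esup (log_ratio V a) +oo%R = -oo%E by rewrite eN ltxx in sup_gt.
apply: limf_esup_eqNy => m.
have a'0 : 0 < a'.
  have [_ /andP[da _]] := xi_alpha n0.
  exact: lt_trans delta_gt0 (lt_trans da (n0P n0 (leqnn _))).
have C0 : 0 < C.
  have := qC 0%N; have h1 : 0 < (q 1%N)%:R :> R by rewrite ltr0n ltnW.
  have h0 : 0 < (q 0%N)%:R :> R by rewrite ltr0n ltnW.
  by move=> /(lt_le_trans h1); rewrite pmulr_lgt0.
have b0 : 0 < a' * delta by rewrite mulr_gt0.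
have [T0 T01 lr] := @log_ratio_le _ m a b0.
have aa' : 0 < a - a' by lra.
(* Beyond [T1] one has [2 * C <= T^(a - a')]; beyond [T2] the index [n0] qualifies; beyond [T3] one
   has [T^a - 1 >= T^a / 2]. *)
pose T1 := (2 * C) `^ (a - a')^-1.
pose T2 := ((q n0).+1%:R : R) `^ a^-1.
pose T3 := (2 : R) `^ a^-1.
exists (T0 + T1 + T2 + T3) => T TT.
have [p1 p2 p3] : [/\ 0 <= T1, 0 <= T2 & 0 <= T3] by split; exact: powR_ge0.
have T_1 : 1 < T by lra.
have Ta x : x `^ a^-1 <= T -> 0 <= x -> x <= T `^ a.
  move=> xT x0; have -> : x = (x `^ a^-1) `^ a by rewrite -powRrM mulVf ?gt_eqF// powRr1.
  by rewrite ge0_ler_powR ?nnegrE ?powR_ge0// ?ltW//; lra.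
have Tn0 : (q n0).+1%:R <= T `^ a by apply: Ta => //; rewrite -/T2; lra.
have Ta2 : 2 <= T `^ a by apply: Ta => //; rewrite -/T3; lra.
pose P l := (n0 <= l)%N && ((q l).+1%:R <= T `^ a).
have [n nP] := cvgny_real (T `^ a) q_infty.
have exP : exists l, P l by exists n0; rewrite /P leqnn.
have bndP l : P l -> (l <= n)%N.
  move=> /andP[_ ql]; rewrite leqNgt; apply/negP => /ltnW/nP h.
  by have := le_trans ql h; rewrite ler_nat ltnn.
have [l /andP[n0l ql] lmax] := ex_maxnP exP bndP.
have qS : T `^ a < (q l.+1).+1%:R.
  rewrite ltNge; apply/negP => h; have := lmax l.+1; rewrite /P h (leqW n0l) => /(_ isT).
  by rewrite ltnn.
have alphal := n0P l n0l; have [_ /andP[da _]] := xi_alpha l.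
have al0 : 0 < alpha l by exact: lt_trans da.
have qR : 1 <= (q l)%:R :> R by rewrite ler1n ltnW.
have qge : T `^ a' <= (q l)%:R.
  have h1 : T `^ a / 2 <= C * (q l)%:R.
    apply: le_trans (qC l); move: qS; rewrite -natr1; lra.
  have h2 : 2 * C <= T `^ (a - a').
    have -> : 2 * C = T1 `^ (a - a').
      by rewrite /T1 -powRrM mulVf ?gt_eqF// powRr1//; lra.
    by rewrite ge0_ler_powR ?nnegrE//; lra.
  have h3 : T `^ a = T `^ a' * T `^ (a - a').
    rewrite -powRD; first by congr (_ `^ _); ring.
    by apply/implyP => _; rewrite gt_eqF//; lra.
  have h4 := powR_ge0 T a'.
  have h5 : T `^ a' * (2 * C) <= T `^ a by rewrite h3 ler_wpM2l.
  have : C * T `^ a' <= C * (q l)%:R by lra.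
  by rewrite ler_pM2l.
apply: (lr T l) => //; first by lra.
  rewrite powRrM ge0_ler_powR ?nnegrE ?powR_ge0// ltW//.
apply: (@le_trans _ _ ((T `^ a') `^ a'^-1)).
  by rewrite -powRrM divff ?gt_eqF// powRr1//; lra.
apply: (@le_trans _ _ ((q l)%:R `^ a'^-1)).
  by rewrite ge0_ler_powR ?nnegrE ?powR_ge0// invr_ge0 ltW.
by rewrite ler_powR// lef_pV2 ?posrE// ltW.
Qed.

End Exponents.

Local Close Scope complex_scope.

Theorem corollary1p10 (R : realType) (V : nat -> R)
    (q : nat -> nat) (U : nat -> {fset interval R})
    (alpha xi : nat -> R) (mu omega zeta : R) :
  (exists M : R, forall n, (0 < n)%N -> `|V n| <= M) ->
  (forall l, (1 < q l)%N) ->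
  (q l @[l --> \oo] --> \oo) ->
  uniformly_clustered V q U alpha xi mu ->
  0 < omega < 1 ->
  scales_nicely U (scale q alpha) mu omega ->
  0 < zeta ->
  (forall l, 2 * omega * ((mu - 1) / (mu - omega)) + zeta < xi l * alpha l) ->
  (alpha_u_minus V <= limn_einf (fun l => (alpha l)%:E))%E /\
  (exponentially_growing (fun l => (q l)%:R : R) ->
   (alpha_u_plus V <= limn_esup (fun l => (alpha l)%:E))%E).
Proof.
move=> [M VM] q1 q_infty [cl [_ _ [delta d0 dP] _]] _ _ _ _.
have xi_alpha l : delta < xi l /\ delta < alpha l < 1 by have [/andP[]] := dP l.
(* Both exponents are suprema of sets to which 0 was added, so 0 has to be bounded as well. *)
have inf0 : (0 <= limn_einf (fun l => (alpha l)%:E))%E.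
  by apply: (@limn_einf_ge _ _ _ 0%N) => l _; have [_ /andP[h _]] := xi_alpha l; lra.
split.
  apply: ge_ereal_sup => _ [->//|[a [a0 fa] <-]].
  exact: (le_limn_einf_of_einf VM q1 q_infty d0 xi_alpha cl a0 fa).
move=> [_ [C qC] _].
apply: ge_ereal_sup => _ [->|[a [a0 fa] <-]].
  by apply: le_trans inf0 _; exact: limn_einf_sup.
apply: (@le_limn_esup_of_esup R V q U alpha xi M delta VM q1 q_infty d0 xi_alpha cl C) => // l.
have ql : 0 < (q l)%:R :> R by rewrite ltr0n ltnW.
rewrite -ler_pdivrMr//; apply: qC; by exists l.
Qed.
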